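(* Work over $\mathbb{C}$. For parameters $c,k,l,m,n,p$ let $T=x+y+c$ and $$P=-\bigl(nx+ky+nT+(m-l)x^2y+px^2T+mxyT+pxT^2\bigr),$$ $$Q=x\bigl(-(n+k)+(l-m)xy-(l+p)xT\bigr).$$ For general values of the parameters (i.e. for all values in a nonempty Zariski open set) the differential form $Pdx+Qdy$, a general differential form of \.{Z}o\l adek's family $CR_{7}$, has the conic integral curve $$\bigl\{(lp-mp)x^2+(lm-m^2+lp-mp)xy+c(lp-mp)x+(-mn+kp)=0\bigr\}$$ and is Darboux integrable. Moreover $X_{CR7}\subset\overline{X_{(2,2)}}$.
   Context: Differential forms. $V^3=\mathbb{C}[x,y,z]_3\oplus\mathbb{C}[x,y,z]_3$ is the vector space of pairs $(P,Q)$ of homogeneous cubic polynomials, written $Pdx+Qdy$; inhomogeneous $P,Q\in\mathbb{C}[x,y]$ of degree $\le3$ are regarded as elements of $V^3$ by homogenizing with $z$. A form is a Poincar\'e differential form if at $(x,y,z)=(0,0,1)$ one has $P=Q=0$, $P_x=Q_y=1$, $P_y=Q_x=0$; the set of these is the $14$-dimensional affine space $V^3_{\text{Poincar\'e}}$. Integral curves and Darboux integrability. For homogeneous $F$, the curve $\{F=0\}\subset\mathbb{P}^2$ is an integral curve of $Pdx+Qdy$ if there is a homogeneous polynomial $K_F$ of degree $2$ (the cofactor) with $PF_y-QF_x=-FK_F$ (after homogenizing). $Pdx+Qdy$ is Darboux integrable if it has integral curves with cofactors $K_1,\dots,K_n$ and there are scalars $\alpha_i$ with $Q_x-P_y=\sum_i\alpha_iK_i$.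 The set $X_{(2,2)}$. It is the set of Poincar\'e forms in $V^3$ having as integral curves two smooth conics such that: neither conic is tangent to the line at infinity $\{z=0\}$; the conics are not tangent to each other; they do not meet the line at infinity at a common point. The bar denotes Zariski closure. The family. $Y_{CR7}\subset V^3$ is the family of all forms obtained from the displayed forms $Pdx+Qdy$ (all parameter values) by affine changes of the coordinates $(x,y)$, and $X_{CR7}=Y_{CR7}\cap V^3_{\text{Poincar\'e}}$. *)

(* Defs.v *)
From HB Require Import structures.
From mathcomp Require Import all_boot all_order all_algebra.
From mathcomp Require Import reals complex.
From mathcomp Require Import mpoly.

Set Implicit Arguments.
Unset Strict Implicit.
Unset Printing Implicit Defensive.

Import GRing.Theory.
Local Open Scope ring_scope.

Section Zariski.
Variables (C : numClosedFieldType) (V : vectType C).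
Implicit Types (A Z U : V -> Prop) (v : V).

(* Polynomials in the coordinates with respect to a basis of V; the resulting
   topology does not depend on the basis. *)
Definition polyfun (f : {mpoly C[\dim {:V}]}) v : C :=
  f.@[fun i => coord (vbasis {:V}) i v].

Definition zariski_closed Z : Prop :=
  exists S : {mpoly C[\dim {:V}]} -> Prop,
    forall v, Z v <-> (forall f, S f -> polyfun f v = 0).

Definition zariski_open U : Prop := zariski_closed (fun v => ~ U v).

Definition zariski_closure A v : Prop :=
  forall Z, zariski_closed Z -> (forall a, A a -> Z a) -> Z v.

End Zariski.

Local Notation "''x'" := (0 : 'I_3) (at level 0).
Local Notation "''y'" := (1 : 'I_3) (at level 0).
Local Notation "''z'" := (2%:R : 'I_3) (at level 0).

Section Forms.
Variable C : numClosedFieldType.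

(* The pair (P, Q) stands for P dx + Q dy. *)
Definition V3 : vectType C := (dhomog 3 C 3 * dhomog 3 C 3)%type.

Definition formP (w : V3) : {mpoly C[3]} := w.1.
Definition formQ (w : V3) : {mpoly C[3]} := w.2.

(* Points of P^2 are represented by nonzero vectors a : 'rV_3; the value of F
   at a is F.@[a 0]. *)
Definition origin : 'rV[C]_3 := delta_mx 0 'z.

Definition poincare (w : V3) : Prop :=
  [/\ (formP w).@[origin 0] = 0 /\ (formQ w).@[origin 0] = 0,
      (formP w)^`M('x).@[origin 0] = 1 /\ (formQ w)^`M('y).@[origin 0] = 1
    & (formP w)^`M('y).@[origin 0] = 0 /\ (formQ w)^`M('x).@[origin 0] = 0].

Definition cofactor (w : V3) (F K : {mpoly C[3]}) : Prop :=
  K \is 2.-homog /\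
  formP w * F^`M('y) - formQ w * F^`M('x) = - (F * K).

Definition plane_curve (d : nat) (F : {mpoly C[3]}) : Prop :=
  [/\ (0 < d)%N, F \is d.-homog & F != 0].

Definition integral_curve (w : V3) (d : nat) (F : {mpoly C[3]}) : Prop :=
  plane_curve d F /\ exists K, cofactor w F K.

Definition darboux_integrable (w : V3) : Prop :=
  exists (n : nat) (d : 'I_n -> nat) (F K : 'I_n -> {mpoly C[3]})
         (alpha : 'I_n -> C),
    (forall i, plane_curve (d i) (F i) /\ cofactor w (F i) (K i)) /\
    (formQ w)^`M('x) - (formP w)^`M('y) = \sum_(i < n) alpha i *: K i.

Definition smooth (F : {mpoly C[3]}) : Prop :=
  forall a : 'rV[C]_3, a != 0 -> F.@[a 0] = 0 ->
    exists i, F^`M(i).@[a 0] != 0.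

(* The tangent line of {F = 0} at a smooth point a, given by its equation. *)
Definition tangent_line (F : {mpoly C[3]}) (a u : 'rV[C]_3) : Prop :=
  \sum_i F^`M(i).@[a 0] * u 0 i = 0.

(* Only used for smooth F and G. *)
Definition tangent (F G : {mpoly C[3]}) : Prop :=
  exists a : 'rV[C]_3,
    [/\ a != 0, F.@[a 0] = 0, G.@[a 0] = 0
      & forall u, tangent_line F a u <-> tangent_line G a u].

Definition line_at_infinity : {mpoly C[3]} := 'X_('z).

Definition smooth_conic (F : {mpoly C[3]}) : Prop :=
  F \is 2.-homog /\ smooth F.

Definition X22 (w : V3) : Prop :=
  poincare w /\
  exists F G : {mpoly C[3]},
    [/\ smooth_conic F /\ integral_curve w 2 F,
        smooth_conic G /\ integral_curve w 2 G,
        ~ tangent F line_at_infinity /\ ~ tangent G line_at_infinity,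
        ~ tangent F G
      & ~ exists a : 'rV[C]_3, [/\ a != 0, F.@[a 0] = 0, G.@[a 0] = 0
                                 & line_at_infinity.@[a 0] = 0]].

(* z^d q(x/z, y/z), for q of degree at most d (terms of larger degree are
   discarded). *)
Definition homogenize (d : nat) (q : {mpoly C[2]}) : {mpoly C[3]} :=
  \sum_(m : 'X_{1..2 < d.+1})
    q@_m *: 'X_[[multinom [tuple m 0; m 1; (d - mdeg m)%N]]].

Lemma homogenize_homog d q : homogenize d q \is d.-homog.
Proof.
apply: rpred_sum => m _; apply: rpredZ; rewrite dhomogX.
have /[!ltnS] lemd : (mdeg m < d.+1)%N := bmdeg m.
apply/eqP; rewrite -[RHS](subnKC lemd) mdegE !big_ord_recr big_ord0 /=.
by rewrite mdegE !big_ord_recr big_ord0 /= !multinomE /= !(tnth_nth 0%N) /=;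
  congr (_ + m _ + m _ + (_ - (_ + m _ + m _)))%N; apply: val_inj.
Qed.

Definition aform := ({mpoly C[2]} * {mpoly C[2]})%type.

Definition homogenize_form (w : aform) : V3 :=
  (DHomog (homogenize_homog 3 w.1), DHomog (homogenize_homog 3 w.2)).

Definition affine_map (A : 'M[C]_2) (b : 'cV[C]_2) : 2.-tuple {mpoly C[2]} :=
  [tuple \sum_(j < 2) A i j *: 'X_j + (b i 0)%:MP | i < 2].

Definition pullback (phi : 2.-tuple {mpoly C[2]}) (w : aform) : aform :=
  let coef j := (w.1 \mPo phi) * (tnth phi 0)^`M(j)
              + (w.2 \mPo phi) * (tnth phi 1)^`M(j) in
  (coef 0, coef 1).

Section CR7.
Variables c k l m n p : C.
Local Notation x := ('X_0 : {mpoly C[2]}).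
Local Notation y := ('X_1 : {mpoly C[2]}).

Let T : {mpoly C[2]} := x + y + c%:MP.

Definition CR7 : aform :=
  ( - (n *: x + k *: y + n *: T + (m - l) *: (x ^+ 2 * y)
       + p *: (x ^+ 2 * T) + m *: (x * y * T) + p *: (x * T ^+ 2)),
    x * (- (n + k)%:MP + (l - m) *: (x * y) - (l + p) *: (x * T)) ).

Definition CR7_conic : {mpoly C[2]} :=
  (l * p - m * p) *: x ^+ 2 + (l * m - m ^+ 2 + l * p - m * p) *: (x * y)
  + (c * (l * p - m * p)) *: x + (- (m * n) + k * p)%:MP.

End CR7.

Definition Y_CR7 (w : V3) : Prop :=
  exists (c k l m n p : C) (A : 'M[C]_2) (b : 'cV[C]_2),
    A \in unitmx /\
    w = homogenize_form (pullback (affine_map A b) (CR7 c k l m n p)).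

Definition X_CR7 (w : V3) : Prop := Y_CR7 w /\ poincare w.

End Forms.

(* Main.v *)
Require Import Defs.
From HB Require Import structures.
From mathcomp Require Import all_boot all_order all_algebra.
From mathcomp Require Import reals complex.
From mathcomp Require Import mpoly.
From mathcomp Require Import ring.

Set Implicit Arguments.
Unset Strict Implicit.
Unset Printing Implicit Defensive.

Import GRing.Theory Num.Theory.
Local Open Scope ring_scope.

(** The form [CR7] is the pull-back, by the quadratic map
    [(U, V) = (x y, x (x + y + c))], of the affine-linear form
    [eta = - (k + l V) dU + (- n + (l - m) U - p V) dV] of the plane
    (homogenize_CR7).

    A general affine-linear form has two invariant lines [f = 0] and [g = 0] and
    equals [l g df + m f dg]. Hence a general pull-back has the two integral
    conics [F] and [G] obtained from [f] and [g], with cofactors proportional to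
    the Jacobian of [(U, V)]. For [CR7] the conic of the statement is one of
    these two. The exterior derivative of the pull-back is also a multiple of
    the Jacobian, and Darboux integrability follows (CR7_integrable) as soon as
    [(l - m) p] is nonzero.

    For [CR7] itself the two conics meet on the line at infinity, so membership
    in the closure of [X22] needs a deformation. Every Poincare form that is a
    pull-back of some affine-linear form by some quadratic map is shown to lie
    in the closure (poincare_pencil_closure). After a translation the quadratic
    map sends the origin to the origin, and there are two cases.

    If [eta] vanishes at the origin, the form is [d(F G) / 2] for two conics
    through the origin whose linear parts are [x + i y] and [x - i y] with
    [i^2 = -1]; their quadratic parts are arbitrary (pencil_node,
    node_closure).

    If [eta] does not vanish at the origin, then in suitable coordinates it is
    [(a1 U + a2 V) dU + (1 + b1 U + b2 V) dV], and the normalization of the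
    linear part amounts to [V = (x^2 + y^2 - a1 L^2) / 2], where [L] is the
    linear part of [U]. The numbers [a1, a2, b1, b2] and the coefficients of [U]
    are free (pencil_fold, foldform_closure).

    In both cases the forms make up a family of Poincare forms parametrized by
    an affine space. The general-position conditions of [X22] follow from the
    nonvanishing of one polynomial in the coefficients of the two conics
    (generic_pair, X22_pull). It is therefore enough to find one member of the
    family where it does not vanish, and to join the given form to this member
    by a line in the parameter space (zariski_limit). *)

(** * Conics given by their coefficients *)

Section Quads.
Variable C : numClosedFieldType.

(** The coefficients of a conic; kept apart from the polynomial so that the
    discriminants below are plain expressions in the field. *)
Record quad := Quad { qxx : C; qxy : C; qyy : C; qxz : C; qyz : C; qzz : C }.

Implicit Types (q r : quad) (a b : C).

Definition qlin a q b r : quad :=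
  Quad (a * qxx q + b * qxx r) (a * qxy q + b * qxy r) (a * qyy q + b * qyy r)
       (a * qxz q + b * qxz r) (a * qyz q + b * qyz r) (a * qzz q + b * qzz r).

Definition qval q (x y z : C) : C :=
  qxx q * x ^+ 2 + qxy q * x * y + qyy q * y ^+ 2
  + qxz q * x * z + qyz q * y * z + qzz q * z ^+ 2.
Definition qdx q (x y z : C) : C := 2 * qxx q * x + qxy q * y + qxz q * z.
Definition qdy q (x y z : C) : C := qxy q * x + 2 * qyy q * y + qyz q * z.
Definition qdz q (x y z : C) : C := qxz q * x + qyz q * y + 2 * qzz q * z.

(** Half the Hessian determinant; it vanishes exactly on singular conics. *)
Definition qdet q : C :=
  4 * qxx q * qyy q * qzz q + qxy q * qxz q * qyz q
  - qxx q * qyz q ^+ 2 - qyy q * qxz q ^+ 2 - qzz q * qxy q ^+ 2.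

(** The derivative of [qdet] at [q] in the direction [r]. *)
Definition qmix q r : C :=
  qxx r * (4 * qyy q * qzz q - qyz q ^+ 2)
  + qyy r * (4 * qxx q * qzz q - qxz q ^+ 2)
  + qzz r * (4 * qxx q * qyy q - qxy q ^+ 2)
  + qxy r * (qxz q * qyz q - 2 * qzz q * qxy q)
  + qxz r * (qxy q * qyz q - 2 * qyy q * qxz q)
  + qyz r * (qxy q * qxz q - 2 * qxx q * qyz q).

Lemma qdet_pencil q r mu :
  qdet (qlin 1 q (- mu) r)
  = qdet q - mu * qmix q r + mu ^+ 2 * qmix r q - mu ^+ 3 * qdet r.
Proof. by rewrite /qdet /qmix /=; ring. Qed.

(** Up to sign, the derivative in [mu] of the cubic of [qdet_pencil]. *)
Lemma qmix_pencil q r mu :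
  qmix (qlin 1 q (- mu) r) r
  = qmix q r - 2 * mu * qmix r q + 3 * mu ^+ 2 * qdet r.
Proof. by rewrite /qdet /qmix /=; ring. Qed.

Definition cubic_disc (a b c d : C) : C :=
  b ^+ 2 * c ^+ 2 - 4 * a * c ^+ 3 - 4 * b ^+ 3 * d
  - 27 * a ^+ 2 * d ^+ 2 + 18 * a * b * c * d.

(** The two equations express [b] and [a] through the other coefficients and
    the double root, and the discriminant vanishes after this substitution. *)
Lemma cubic_disc_double_root (a b c d mu : C) :
  a + b * mu + c * mu ^+ 2 + d * mu ^+ 3 = 0 ->
  b + 2 * c * mu + 3 * d * mu ^+ 2 = 0 ->
  cubic_disc a b c d = 0.
Proof.
move=> p0 p1.
have -> : b = - (2 * c * mu + 3 * d * mu ^+ 2).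
  by apply/eqP; rewrite -addr_eq0 addrA p1.
have -> : a = c * mu ^+ 2 + 2 * d * mu ^+ 3.
  transitivity (a + b * mu + c * mu ^+ 2 + d * mu ^+ 3
    - mu * (b + 2 * c * mu + 3 * d * mu ^+ 2)
    + (c * mu ^+ 2 + 2 * d * mu ^+ 3)); first by ring.
  by rewrite p0 p1 mulr0 subr0 add0r.
by rewrite /cubic_disc; ring.
Qed.

Definition disc_inf q : C := qxy q ^+ 2 - 4 * qxx q * qyy q.

(** The resultant of the two binary forms cut out on the line at infinity. *)
Definition res_inf q r : C :=
  (qxx q * qyy r - qxx r * qyy q) ^+ 2
  - (qxx q * qxy r - qxx r * qxy q) * (qxy q * qyy r - qxy r * qyy q).

(** A single polynomial in the coefficients whose nonvanishing forces every
    general-position condition in the definition of [X22]. The last factor is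
    the discriminant of [mu |-> qdet (q - mu r)]: it is nonzero when the pencil
    has three distinct singular members. *)
Definition generic_pair q r : C :=
  qdet q * qdet r * disc_inf q * disc_inf r * res_inf q r
  * cubic_disc (qdet q) (- qmix q r) (qmix r q) (- qdet r).

(** Cramer's rule for the Hessian matrix, written out. *)
Lemma qdet_singular q x y z : qdet q != 0 ->
  qdx q x y z = 0 -> qdy q x y z = 0 -> qdz q x y z = 0 ->
  [/\ x = 0, y = 0 & z = 0].
Proof.
move=> dn0 h0 h1 h2.
have two : 2 * qdet q != 0 by rewrite mulf_neq0 // pnatr_eq0.
suff H : [/\ 2 * qdet q * x = 0, 2 * qdet q * y = 0 & 2 * qdet q * z = 0].
  by case: H; split; apply: (mulfI two); rewrite mulr0.
split.
- transitivity ((4 * qyy q * qzz q - qyz q ^+ 2) * qdx q x y z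
   + (qxz q * qyz q - 2 * qzz q * qxy q) * qdy q x y z
   + (qxy q * qyz q - 2 * qyy q * qxz q) * qdz q x y z).
    by rewrite /qdet /qdx /qdy /qdz; ring.
  by rewrite h0 h1 h2; ring.
- transitivity ((qxz q * qyz q - 2 * qzz q * qxy q) * qdx q x y z
   + (4 * qxx q * qzz q - qxz q ^+ 2) * qdy q x y z
   + (qxy q * qxz q - 2 * qxx q * qyz q) * qdz q x y z).
    by rewrite /qdet /qdx /qdy /qdz; ring.
  by rewrite h0 h1 h2; ring.
- transitivity ((qxy q * qyz q - 2 * qyy q * qxz q) * qdx q x y z
   + (qxy q * qxz q - 2 * qxx q * qyz q) * qdy q x y z
   + (4 * qxx q * qyy q - qxy q ^+ 2) * qdz q x y z).
    by rewrite /qdet /qdx /qdy /qdz; ring.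
  by rewrite h0 h1 h2; ring.
Qed.

Lemma disc_inf_singular q x y : disc_inf q != 0 ->
  2 * qxx q * x + qxy q * y = 0 -> qxy q * x + 2 * qyy q * y = 0 ->
  x = 0 /\ y = 0.
Proof.
move=> dn0 h0 h1; split; apply: (mulfI dn0); rewrite mulr0.
- transitivity (qxy q * (qxy q * x + 2 * qyy q * y)
    - 2 * qyy q * (2 * qxx q * x + qxy q * y)); first by rewrite /disc_inf; ring.
  by rewrite h0 h1; ring.
- transitivity (qxy q * (2 * qxx q * x + qxy q * y)
    - 2 * qxx q * (qxy q * x + 2 * qyy q * y)); first by rewrite /disc_inf; ring.
  by rewrite h0 h1; ring.
Qed.

Lemma res_inf_common q r x y : res_inf q r != 0 ->
  qval q x y 0 = 0 -> qval r x y 0 = 0 -> x = 0 /\ y = 0.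
Proof.
move=> rn0 h0 h1.
have {}h0 : qxx q * x ^+ 2 + qxy q * x * y + qyy q * y ^+ 2 = 0.
  by rewrite -h0 /qval; ring.
have {}h1 : qxx r * x ^+ 2 + qxy r * x * y + qyy r * y ^+ 2 = 0.
  by rewrite -h1 /qval; ring.
pose m := qxx q * qyy r - qxx r * qyy q.
pose n := qxx q * qxy r - qxx r * qxy q.
pose k := qxy q * qyy r - qxy r * qyy q.
have e1 : x * (m * x + k * y) = 0.
  transitivity (qyy r * (qxx q * x ^+ 2 + qxy q * x * y + qyy q * y ^+ 2)
    - qyy q * (qxx r * x ^+ 2 + qxy r * x * y + qyy r * y ^+ 2)).
    by rewrite /m /k; ring.
  by rewrite h0 h1; ring.
have e2 : y * (n * x + m * y) = 0.
  transitivity (qxx q * (qxx r * x ^+ 2 + qxy r * x * y + qyy r * y ^+ 2)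
    - qxx r * (qxx q * x ^+ 2 + qxy q * x * y + qyy q * y ^+ 2)).
    by rewrite /m /n; ring.
  by rewrite h0 h1; ring.
have ex : x ^+ 2 * y * res_inf q r = 0.
  transitivity (y * m * (x * (m * x + k * y)) - x * k * (y * (n * x + m * y))).
    by rewrite /res_inf /m /n /k; ring.
  by rewrite e1 e2; ring.
have [x0|xn0] := eqVneq x 0; have [y0|yn0] := eqVneq y 0 => //; exfalso.
- have : qyy q * y ^+ 2 = 0 by rewrite -h0 x0; ring.
  have : qyy r * y ^+ 2 = 0 by rewrite -h1 x0; ring.
  move=> /eqP; rewrite mulf_eq0 expf_eq0 /= (negPf yn0) orbF => /eqP r0.
  move=> /eqP; rewrite mulf_eq0 expf_eq0 /= (negPf yn0) orbF => /eqP q0.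
  by move/eqP: rn0; apply; rewrite /res_inf q0 r0; ring.
- have : qxx q * x ^+ 2 = 0 by rewrite -h0 y0; ring.
  have : qxx r * x ^+ 2 = 0 by rewrite -h1 y0; ring.
  move=> /eqP; rewrite mulf_eq0 expf_eq0 /= (negPf xn0) orbF => /eqP r0.
  move=> /eqP; rewrite mulf_eq0 expf_eq0 /= (negPf xn0) orbF => /eqP q0.
  by move/eqP: rn0; apply; rewrite /res_inf q0 r0; ring.
- by move: (mulf_neq0 (mulf_neq0 (expf_neq0 2 xn0) yn0) rn0); rewrite ex eqxx.
Qed.

Definition qcycle q : quad := Quad (qyy q) (qyz q) (qzz q) (qxy q) (qxz q) (qxx q).

(** If the Hessian matrix of [q] kills [a = (x, y, z)], its adjugate is a
    multiple of [a a^T], so pairing the adjugate with [r] gives a multiple of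
    [r(a)]. *)
Lemma qmix_singular_z q r x y z : z != 0 ->
  qdx q x y z = 0 -> qdy q x y z = 0 -> qdz q x y z = 0 ->
  qval r x y z = 0 -> qmix q r = 0.
Proof.
move=> zn0 h0 h1 h2 hv.
have z2 : z ^+ 2 != 0 by rewrite expf_neq0.
apply: (mulfI z2); rewrite mulr0.
transitivity ((4 * qxx q * qyy q - qxy q ^+ 2) * qval r x y z); last first.
  by rewrite hv mulr0.
have exz : qxz q = - (2 * qxx q * x + qxy q * y) / z.
  apply: (mulIf zn0); rewrite divfK //; apply/eqP.
  by rewrite -addr_eq0 addrC; apply/eqP; exact: h0.
have eyz : qyz q = - (qxy q * x + 2 * qyy q * y) / z.
  apply: (mulIf zn0); rewrite divfK //; apply/eqP.
  by rewrite -addr_eq0 addrC; apply/eqP; exact: h1.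
have ezz : qzz q = - (qxz q * x + qyz q * y) / (2 * z).
  apply: (mulIf (_ : 2 * z != 0)); first by rewrite mulf_neq0 // pnatr_eq0.
  rewrite divfK ?mulf_neq0 ?pnatr_eq0 //; apply/eqP.
  by rewrite -addr_eq0 addrC; apply/eqP; rewrite -h2 /qdz; ring.
by rewrite /qmix /qval ezz exz eyz; field.
Qed.

(** [qmix] is invariant under permutations of the coordinates, which moves a
    nonzero coordinate of the point to the last place. *)
Lemma qmix_singular q r x y z : [|| x != 0, y != 0 | z != 0] ->
  qdx q x y z = 0 -> qdy q x y z = 0 -> qdz q x y z = 0 ->
  qval r x y z = 0 -> qmix q r = 0.
Proof.
move=> /or3P[] n0 h0 h1 h2 hv.
- have -> : qmix q r = qmix (qcycle q) (qcycle r) by rewrite /qmix /=; ring.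
  apply: (@qmix_singular_z _ _ y z x) => //.
  + by rewrite -h1 /qdx /qdy /=; ring.
  + by rewrite -h2 /qdz /qdy /=; ring.
  + by rewrite -h0 /qdx /qdz /=; ring.
  + by rewrite -hv /qval /=; ring.
- have -> : qmix q r = qmix (qcycle (qcycle q)) (qcycle (qcycle r)).
    by rewrite /qmix /=; ring.
  apply: (@qmix_singular_z _ _ z x y) => //.
  + by rewrite -h2 /qdx /qdz /=; ring.
  + by rewrite -h0 /qdx /qdy /=; ring.
  + by rewrite -h1 /qdy /qdz /=; ring.
  + by rewrite -hv /qval /=; ring.
- exact: (qmix_singular_z n0 h0 h1 h2 hv).
Qed.

End Quads.

(** * General position of two plane conics *)

(** Locked, so that rewriting with the morphism lemmas for derivatives and
    evaluation stops at [conic q]. *)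
HB.lock Definition conic (C : numClosedFieldType) (q : quad C) : {mpoly C[3]} :=
  qxx q *: 'X_0 ^+ 2 + qxy q *: ('X_0 * 'X_1) + qyy q *: 'X_1 ^+ 2
  + qxz q *: ('X_0 * 'X_(2%:R)) + qyz q *: ('X_1 * 'X_(2%:R))
  + qzz q *: 'X_(2%:R) ^+ 2.
Canonical conic_unlockable := Unlockable conic.unlock.

Section Conics.
Variable C : numClosedFieldType.
Implicit Types (q r : quad C) (w : V3 C) (F G : {mpoly C[3]}).

Local Notation X := ('X_0 : {mpoly C[3]}).
Local Notation Y := ('X_1 : {mpoly C[3]}).
Local Notation Z := ('X_(2%:R) : {mpoly C[3]}).

Lemma conicE q : conic q =
  qxx q *: X ^+ 2 + qxy q *: (X * Y) + qyy q *: Y ^+ 2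
  + qxz q *: (X * Z) + qyz q *: (Y * Z) + qzz q *: Z ^+ 2.
Proof. by rewrite unlock. Qed.

Lemma mderivXU n (i j : 'I_n) :
  ('X_j : {mpoly C[n]})^`M(i) = ((j == i)%:R)%:MP.
Proof.
rewrite mderivX mnm1E; case: eqP => [->|_]; last by rewrite scale0r mpolyC0.
by rewrite scale1r -[X in 'X_[X - _]]add0m addmK mpolyX0 mpolyC1.
Qed.

Lemma dhomogXU n (i : 'I_n) : ('X_i : {mpoly C[n]}) \is 1.-homog.
Proof. by rewrite dhomogX /= mdeg1. Qed.

Lemma conic_homog q : conic q \is 2.-homog.
Proof.
have h (i j : 'I_3) : ('X_i * 'X_j : {mpoly C[3]}) \is 2.-homog.
  by apply: (@dhomogM _ _ _ 1%N _ 1%N); exact: dhomogXU.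
by rewrite conicE !expr2 !dhomogD // dhomogZ.
Qed.

Lemma meval_conic q (v : 'I_3 -> C) :
  (conic q).@[v] = qval q (v 0) (v 1) (v 2%:R).
Proof.
by rewrite !conicE /qval !mevalD !mevalZ ?expr2 !mevalM !mevalXU !mulrA.
Qed.

Lemma mderiv_conic q i :
  (conic q)^`M(i) =
  if i == 0 then (2 * qxx q) *: X + qxy q *: Y + qxz q *: Z
  else if i == 1 then qxy q *: X + (2 * qyy q) *: Y + qyz q *: Z
  else qxz q *: X + qyz q *: Y + (2 * qzz q) *: Z.
Proof.
rewrite !conicE !mderivD !mderivZ ?expr2 !mderivM !mderivXU.
have [->|->|->] : [\/ i = 0, i = 1 | i = 2%:R].
  case: i => [[|[|[|//]]] ilt]; [apply: Or31 | apply: Or32 | apply: Or33];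
  exact: val_inj.
all: rewrite /= ?mpolyC0 ?mpolyC1 -!mul_mpolyC ?rmorphM ?rmorph_nat; ring.
Qed.

Lemma meval_conic_dx q (v : 'I_3 -> C) :
  (conic q)^`M(0).@[v] = qdx q (v 0) (v 1) (v 2%:R).
Proof. by rewrite mderiv_conic /= !mevalD !mevalZ !mevalXU. Qed.

Lemma meval_conic_dy q (v : 'I_3 -> C) :
  (conic q)^`M(1).@[v] = qdy q (v 0) (v 1) (v 2%:R).
Proof. by rewrite mderiv_conic /= !mevalD !mevalZ !mevalXU. Qed.

Lemma meval_conic_dz q (v : 'I_3 -> C) :
  (conic q)^`M(2%:R).@[v] = qdz q (v 0) (v 1) (v 2%:R).
Proof. by rewrite mderiv_conic /= !mevalD !mevalZ !mevalXU. Qed.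

Lemma conic_qlin a q b r : conic (qlin a q b r) = a *: conic q + b *: conic r.
Proof.
by rewrite !conicE /qlin /= -!mul_mpolyC !rmorphD !rmorphM /=; ring.
Qed.

(** The quadric [e0 z^2 + e1 q + e2 r], that is, the affine function
    [e0 + e1 u + e2 v] composed with the quadratic map [(u, v) = (q, r)]. *)
Definition qaff (e0 e1 e2 : C) q r : quad C :=
  Quad (e1 * qxx q + e2 * qxx r) (e1 * qxy q + e2 * qxy r) (e1 * qyy q + e2 * qyy r)
       (e1 * qxz q + e2 * qxz r) (e1 * qyz q + e2 * qyz r)
       (e0 + e1 * qzz q + e2 * qzz r).

Lemma conic_qaff e0 e1 e2 q r :
  conic (qaff e0 e1 e2 q r) = e0 *: Z ^+ 2 + e1 *: conic q + e2 *: conic r.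
Proof.
by rewrite !conicE /qaff /= -!mul_mpolyC !(rmorphD, rmorphM) /=; ring.
Qed.

Lemma row3_neq0 (a : 'rV[C]_3) : a != 0 ->
  [|| a 0 0 != 0, a 0 1 != 0 | a 0 2%:R != 0].
Proof.
apply: contraR; rewrite !negb_or !negbK => /and3P[/eqP a0 /eqP a1 /eqP a2].
apply/eqP/rowP => -[[|[|[|//]]] ilt]; rewrite mxE.
- by rewrite -a0; congr (a _ _); exact: val_inj.
- by rewrite -a1; congr (a _ _); exact: val_inj.
- by rewrite -a2; congr (a _ _); exact: val_inj.
Qed.

Lemma sum_delta (f : 'I_3 -> C) (b d : C) (j k : 'I_3) :
  \sum_i f i * (b *: delta_mx 0 j - d *: delta_mx 0 k : 'rV_3) 0 i
  = b * f j - d * f k.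
Proof.
under eq_bigr => i _ do rewrite !mxE eqxx /= mulrBr.
rewrite sumrB (bigD1 j) //= [X in _ - X](bigD1 k) //= !eqxx !mulr1.
rewrite !big1 ?addr0 1?[b * _]mulrC 1?[d * _]mulrC // => i /negPf ->;
  by rewrite !mulr0.
Qed.

Lemma smooth_conic_qdet q : qdet q != 0 -> smooth (conic q).
Proof.
move=> dn0 a /row3_neq0 an0 _.
case: (eqVneq ((conic q)^`M(0).@[a 0]) 0) => [h0|]; last by exists 0.
case: (eqVneq ((conic q)^`M(1).@[a 0]) 0) => [h1|]; last by exists 1.
case: (eqVneq ((conic q)^`M(2%:R).@[a 0]) 0) => [h2|]; last by exists 2%:R.
rewrite meval_conic_dx in h0; rewrite meval_conic_dy in h1.
rewrite meval_conic_dz in h2.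
have [e0 e1 e2] := qdet_singular dn0 h0 h1 h2.
by move: an0; rewrite e0 e1 e2 eqxx.
Qed.

Lemma conic_neq0 q : qdet q != 0 -> conic q != 0.
Proof.
move=> dn0; apply/eqP => q0.
have e0 : delta_mx 0 0 != 0 :> 'rV[C]_3.
  by apply/eqP => /rowP/(_ 0) /eqP; rewrite !mxE eqxx oner_eq0.
have [|i] := smooth_conic_qdet dn0 e0; first by rewrite q0 meval0.
by rewrite q0 mderiv0 meval0 eqxx.
Qed.

Lemma not_tangent_infinity q : disc_inf q != 0 ->
  ~ tangent (conic q) (line_at_infinity C).
Proof.
move=> dn0 [a [an0 _ /[!mevalXU] az0 ht]].
have grad0 j : j != 2%:R -> (conic q)^`M(j).@[a 0] = 0.
  move=> j2; have [_] := ht (1 *: delta_mx 0 j - 0 *: delta_mx 0 j).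
  rewrite /tangent_line !sum_delta !mul1r !mul0r !subr0; apply.
  by rewrite /line_at_infinity mderivXU mevalC eq_sym (negPf j2).
have /(_ isT) h0 := grad0 0; have /(_ isT) h1 := grad0 1.
rewrite meval_conic_dx /qdx az0 mulr0 addr0 in h0.
rewrite meval_conic_dy /qdy az0 mulr0 addr0 in h1.
have [e0 e1] := disc_inf_singular dn0 h0 h1.
by move: (row3_neq0 an0); rewrite az0 e0 e1 eqxx.
Qed.

Lemma not_common_infinity q r : res_inf q r != 0 ->
  ~ exists a : 'rV[C]_3, [/\ a != 0, (conic q).@[a 0] = 0, (conic r).@[a 0] = 0
                           & (line_at_infinity C).@[a 0] = 0].
Proof.
move=> rn0 [a [an0]]; rewrite !meval_conic mevalXU => hq hr az0.
rewrite az0 in hq hr; have [e0 e1] := res_inf_common rn0 hq hr.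
by move: (row3_neq0 an0); rewrite az0 e0 e1 eqxx.
Qed.

(** At a common tangency point [a] the gradients are proportional, so some
    member [q - mu r] of the pencil is singular at [a], while [r(a) = 0]. By
    [qmix_singular] the cubic [qdet (q - mu r)] and its derivative both vanish
    at [mu]. *)
Lemma not_tangent q r : qdet r != 0 ->
  cubic_disc (qdet q) (- qmix q r) (qmix r q) (- qdet r) != 0 ->
  ~ tangent (conic q) (conic r).
Proof.
move=> rn0 dn0 [a [/row3_neq0 an0 hq hr ht]].
suff [mu hmu] : exists mu,
    forall j, (conic q)^`M(j).@[a 0] = mu * (conic r)^`M(j).@[a 0].
  have h0 : qdx (qlin 1 q (- mu) r) (a 0 0) (a 0 1) (a 0 2%:R) = 0.
    transitivity (qdx q (a 0 0) (a 0 1) (a 0 2%:R)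
                  - mu * qdx r (a 0 0) (a 0 1) (a 0 2%:R)).
      by rewrite /qdx /=; ring.
    by rewrite -!meval_conic_dx hmu subrr.
  have h1 : qdy (qlin 1 q (- mu) r) (a 0 0) (a 0 1) (a 0 2%:R) = 0.
    transitivity (qdy q (a 0 0) (a 0 1) (a 0 2%:R)
                  - mu * qdy r (a 0 0) (a 0 1) (a 0 2%:R)).
      by rewrite /qdy /=; ring.
    by rewrite -!meval_conic_dy hmu subrr.
  have h2 : qdz (qlin 1 q (- mu) r) (a 0 0) (a 0 1) (a 0 2%:R) = 0.
    transitivity (qdz q (a 0 0) (a 0 1) (a 0 2%:R)
                  - mu * qdz r (a 0 0) (a 0 1) (a 0 2%:R)).
      by rewrite /qdz /=; ring.
    by rewrite -!meval_conic_dz hmu subrr.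
  have det0 : qdet (qlin 1 q (- mu) r) = 0.
    apply/eqP; apply: contraT => /qdet_singular/(_ h0 h1 h2) [e0 e1 e2].
    by move: an0; rewrite e0 e1 e2 eqxx.
  have hv : qval r (a 0 0) (a 0 1) (a 0 2%:R) = 0 by rewrite -hr meval_conic.
  have mix0 := qmix_singular an0 h0 h1 h2 hv.
  move/eqP: dn0; apply; apply: (@cubic_disc_double_root _ _ _ _ _ mu).
    by rewrite -det0 qdet_pencil; ring.
  by rewrite -[RHS]oppr0 -mix0 qmix_pencil; ring.
have an : a != 0 by apply: contraTneq an0 => ->; rewrite !mxE eqxx.
have [i gi0] := smooth_conic_qdet rn0 an hr.
exists ((conic q)^`M(i).@[a 0] / (conic r)^`M(i).@[a 0]) => j.
have [_] := ht ((conic r)^`M(i).@[a 0] *: delta_mx 0 j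
                - (conic r)^`M(j).@[a 0] *: delta_mx 0 i).
rewrite /tangent_line !sum_delta => /(_ _).
rewrite mulrC subrr => /(_ erefl) /eqP; rewrite subr_eq0 => /eqP e.
by apply: (mulfI gi0); rewrite e; field.
Qed.

End Conics.

(** * Polynomial curves and the Zariski closure *)

Section PolynomialCurves.
Variable C : numClosedFieldType.

(** Stated for functions rather than polynomials, so that the closure lemmas
    below apply to expressions in the parameter by unification. *)
Definition polyc (h : C -> C) : Prop := exists p : {poly C}, forall t, h t = p.[t].

Lemma polyc_const a : polyc (fun=> a).
Proof. by exists a%:P => t; rewrite hornerC. Qed.

Lemma polyc_id : polyc (fun t => t).
Proof. by exists 'X => t; rewrite hornerX. Qed.

Lemma polycD f g : polyc f -> polyc g -> polyc (fun t => f t + g t).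
Proof. by case=> p hp [p' hp']; exists (p + p') => t; rewrite hornerD hp hp'. Qed.

Lemma polycM f g : polyc f -> polyc g -> polyc (fun t => f t * g t).
Proof. by case=> p hp [p' hp']; exists (p * p') => t; rewrite hornerM hp hp'. Qed.

Lemma polycN f : polyc f -> polyc (fun t => - f t).
Proof. by case=> p hp; exists (- p) => t; rewrite hornerN hp. Qed.

Lemma polycX f n : polyc f -> polyc (fun t => f t ^+ n).
Proof. by case=> p hp; exists (p ^+ n) => t; rewrite horner_exp hp. Qed.

Lemma polyc_sum (I : Type) (s : seq I) (P : pred I) (f : I -> C -> C) :
  (forall i, polyc (f i)) -> polyc (fun t => \sum_(i <- s | P i) f i t).
Proof.
move=> hf; elim: s => [|i s IHs].
  by exists 0 => t; rewrite big_nil horner0.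
case Pi : (P i); last by have [p hp] := IHs; exists p => t; rewrite big_cons Pi hp.
by have [p hp] := polycD (hf i) IHs; exists p => t; rewrite big_cons Pi hp.
Qed.

Lemma polyc_prod (I : Type) (s : seq I) (f : I -> C -> C) :
  (forall i, polyc (f i)) -> polyc (fun t => \prod_(i <- s) f i t).
Proof.
move=> hf; elim: s => [|i s IHs].
  by exists 1 => t; rewrite big_nil hornerC.
by have [p hp] := polycM (hf i) IHs; exists p => t; rewrite big_cons hp.
Qed.

Lemma polyc_ext f g : f =1 g -> polyc f -> polyc g.
Proof. by move=> fg [p hp]; exists p => t; rewrite -fg. Qed.

End PolynomialCurves.

Ltac polyc :=
  repeat first [ assumption | exact: polyc_const | exact: polyc_id
               | apply: polycD | apply: polycM | apply: polycN | apply: polycX ].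

Section Closure.
Variable C : numClosedFieldType.
Implicit Types (q r : C -> quad C) (w : V3 C).

Definition qpolyc (q : C -> quad C) : Prop :=
  [/\ polyc (fun t => qxx (q t)), polyc (fun t => qxy (q t)) &
      polyc (fun t => qyy (q t))] /\
  [/\ polyc (fun t => qxz (q t)), polyc (fun t => qyz (q t)) &
      polyc (fun t => qzz (q t))].

Lemma generic_pair_polyc q r : qpolyc q -> qpolyc r ->
  polyc (fun t => generic_pair (q t) (r t)).
Proof.
move=> [[q1 q2 q3] [q4 q5 q6]] [[r1 r2 r3] [r4 r5 r6]].
rewrite /generic_pair /cubic_disc /res_inf /disc_inf /qmix /qdet.
polyc.
Qed.

Lemma qlin_polyc a q b r : polyc a -> polyc b -> qpolyc q -> qpolyc r ->
  qpolyc (fun t => qlin (a t) (q t) (b t) (r t)).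
Proof.
move=> ha hb [[q1 q2 q3] [q4 q5 q6]] [[r1 r2 r3] [r4 r5 r6]].
by split; split; rewrite /qlin /=; polyc.
Qed.

Lemma qaff_polyc a b c q r : polyc a -> polyc b -> polyc c -> qpolyc q -> qpolyc r ->
  qpolyc (fun t => qaff (a t) (b t) (c t) (q t) (r t)).
Proof.
move=> ha hb hc [[q1 q2 q3] [q4 q5 q6]] [[r1 r2 r3] [r4 r5 r6]].
by split; split; rewrite /qaff /=; polyc.
Qed.

Definition mpolyc n (F : C -> {mpoly C[n]}) : Prop :=
  forall m, polyc (fun t => (F t)@_m).

Lemma mpolyc_ext n (F G : C -> {mpoly C[n]}) : F =1 G -> mpolyc F -> mpolyc G.
Proof. by move=> FG hF m; apply: polyc_ext (hF m) => t; rewrite FG. Qed.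

Lemma mpolycD n (F G : C -> {mpoly C[n]}) :
  mpolyc F -> mpolyc G -> mpolyc (fun t => F t + G t).
Proof.
move=> hF hG m; apply: (polyc_ext _ (polycD (hF m) (hG m))) => t.
by rewrite mcoeffD.
Qed.

Lemma mpolycZ n h (F : C -> {mpoly C[n]}) :
  polyc h -> mpolyc F -> mpolyc (fun t => h t *: F t).
Proof.
move=> hh hF m; apply: (polyc_ext _ (polycM hh (hF m))) => t.
by rewrite mcoeffZ.
Qed.

Lemma mpolycM n (F G : C -> {mpoly C[n]}) :
  mpolyc F -> mpolyc G -> mpolyc (fun t => F t * G t).
Proof.
move=> hF hG m; apply: polyc_ext; first by move=> t; rewrite mcoeffM.
by apply: polyc_sum => k; exact: polycM.
Qed.

Lemma mpolyc_deriv n i (F : C -> {mpoly C[n]}) :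
  mpolyc F -> mpolyc (fun t => (F t)^`M(i)).
Proof.
move=> hF m; apply: polyc_ext; first by move=> t; rewrite mcoeff_deriv -mulr_natr.
by apply: polycM; [exact: hF | exact: polyc_const].
Qed.

Lemma mpolyc_const n (F : {mpoly C[n]}) : mpolyc (fun=> F).
Proof. by move=> m; exact: polyc_const. Qed.

Lemma conic_polyc q : qpolyc q -> mpolyc (fun t => conic (q t)).
Proof.
move=> [[q1 q2 q3] [q4 q5 q6]]; apply: mpolyc_ext.
  by move=> t; rewrite conicE.
by do ! [apply: mpolycD]; apply: mpolycZ => //; exact: mpolyc_const.
Qed.

(** This is how polynomiality of the coefficients of [P] and [Q] reaches the
    coordinates used by the Zariski topology. *)
Lemma form_coord (i : 'I_(\dim {:V3 C})) :
  exists a b : 'X_{1..3 < 4} -> C, forall w, coord (vbasis {:V3 C}) i w =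
    \sum_(m : 'X_{1..3 < 4}) (formP w)@_m * a m
    + \sum_(m : 'X_{1..3 < 4}) (formQ w)@_m * b m.
Proof.
pose mon (m : 'X_{1..3}) : dhomog 3 C 3 := DHomog (pihomogP mdeg 3 'X_[m]).
exists (fun m => coord (vbasis {:V3 C}) i (mon m, 0)).
exists (fun m => coord (vbasis {:V3 C}) i (0, mon m)) => w.
have expand (p : dhomog 3 C 3) : p = \sum_(m : 'X_{1..3 < 4}) (val p)@_m *: mon m.
  apply: val_inj; rewrite raddf_sum /=.
  have hp : val p \is 3.-homog by exact: dhomog_is_dhomog.
  have sp : (msize (val p) <= 4)%N.
    have [->|pn0] := eqVneq (val p) 0; first by rewrite msize0.
    have := dhomog_msize hp => h1.
    by have := dhomog_uniq pn0 hp h1; case: (msize _) => // k /= <-.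
  rewrite -[LHS](pihomog_dE hp) [in LHS](mpolywE sp) raddf_sum /=.
  by apply: eq_bigr => m _; rewrite linearZ.
pose DD : vectType C := (dhomog 3 C 3 * dhomog 3 C 3)%type.
have e : w = \sum_(m : 'X_{1..3 < 4}) (formP w)@_m *: ((mon m, 0) : DD)
  + \sum_(m : 'X_{1..3 < 4}) (formQ w)@_m *: ((0, mon m) : DD) :> DD.
  apply: injective_projections; rewrite raddfD /= !raddf_sum /=.
    rewrite [X in _ + X]big1 ?addr0; last by move=> m _; rewrite scaler0.
    exact: expand.
  rewrite [X in X + _]big1 ?add0r; last by move=> m _; rewrite scaler0.
  exact: expand.
rewrite {1}e linearD !linear_sum /=.
by congr (_ + _); apply: eq_bigr => m _; rewrite linearZ.
Qed.

Lemma exists_nonroot (p : {poly C}) : p != 0 -> exists x, p.[x] != 0.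
Proof.
move=> pn0; pose s := [seq i%:R : C | i <- iota 0 (size p)].
have /allPn[x _ xroot] : ~~ all (root p) s; last by exists x.
apply: contra pn0 => hs; apply/eqP; apply: (roots_geq_poly_eq0 hs).
- by rewrite map_inj_uniq ?iota_uniq // => i j /eqP; rewrite eqr_nat => /eqP.
- by rewrite size_map size_iota.
Qed.

Lemma poly_all_roots (p : {poly C}) : (forall t, p.[t] = 0) -> p = 0.
Proof.
by move=> hp; apply/eqP; apply: contraT => /exists_nonroot[x]; rewrite hp eqxx.
Qed.

(** The affine line is irreducible: a regular function that vanishes wherever
    the nonzero function [h] does not vanish is zero. *)
Lemma polyc_nonroot (h : C -> C) (a : C) : polyc h -> h a != 0 ->
  forall k, polyc k -> (forall t, h t != 0 -> k t = 0) -> forall t, k t = 0.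
Proof.
move=> [p hp] ha k [p' hp'] hk t.
have /eqP : p * p' = 0.
  apply: poly_all_roots => s; rewrite hornerM -hp -hp'.
  by have [->|/hk ->] := eqVneq (h s) 0; rewrite ?mul0r ?mulr0.
rewrite mulf_eq0 => /orP[] /eqP e; last by rewrite hp' e horner0.
by move: ha; rewrite hp e horner0 eqxx.
Qed.

Lemma polyfun_polyc (w : C -> V3 C) (f : {mpoly C[\dim {:V3 C}]}) :
  mpolyc (fun t => formP (w t)) -> mpolyc (fun t => formQ (w t)) ->
  polyc (fun t => polyfun f (w t)).
Proof.
move=> hP hQ; apply: polyc_ext; first by move=> t; rewrite /polyfun mevalE.
apply: polyc_sum => m; apply: polycM; first exact: polyc_const.
apply: polyc_prod => i; apply: polycX.
have [a [b hab]] := form_coord i; apply: polyc_ext; first by move=> t; rewrite hab.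
apply: polycD; apply: polyc_sum => m'; apply: polycM; try exact: polyc_const.
- exact: hP.
- exact: hQ.
Qed.

Lemma zariski_closureS (A : V3 C -> Prop) w : A w -> zariski_closure A w.
Proof. by move=> Aw Z _; apply. Qed.

(** The closure argument used throughout: a form lies in a Zariski closure as
    soon as it is the point [t = 0] of a polynomial curve whose generic point
    does; it suffices to exhibit one good parameter, here [t = 1]. *)
Lemma zariski_limit (A : V3 C -> Prop) (w : C -> V3 C) (g : C -> C) :
  mpolyc (fun t => formP (w t)) -> mpolyc (fun t => formQ (w t)) ->
  polyc g -> g 1 != 0 -> (forall t, g t != 0 -> zariski_closure A (w t)) ->
  zariski_closure A (w 0).
Proof.
move=> hP hQ hg g1 hA Z [S hS] AZ; apply/hS => f Sf.
apply: (polyc_nonroot hg g1 (polyfun_polyc f hP hQ)) => t gt0.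
by have /hS := hA t gt0 Z (ex_intro _ S hS) AZ; apply.
Qed.

Lemma zariski_open_nonzero (V : vectType C) (g : V -> C)
    (f : {mpoly C[\dim {:V}]}) :
  g =1 polyfun f -> zariski_open (fun v => g v != 0).
Proof.
move=> gf; exists (eq f) => v; split.
  by move=> /negP/negPn/eqP gv _ <-; rewrite -gf.
by move=> /(_ f erefl); rewrite -gf => ->; rewrite eqxx.
Qed.

End Closure.

(** * Pull-backs by quadratic maps *)

Section Pullback.
Variable C : numClosedFieldType.
Implicit Types (q r alpha beta : quad C) (w : V3 C) (P Q : {mpoly C[3]}).

(** Projecting on degree 3 makes this total; on cubic [P] and [Q] the
    projection is the identity. *)
Definition form3 P Q : V3 C :=
  (DHomog (pihomogP mdeg 3 P), DHomog (pihomogP mdeg 3 Q)).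

Lemma formP_form3 P Q : P \is 3.-homog -> formP (form3 P Q) = P.
Proof. exact: pihomog_dE. Qed.

Lemma formQ_form3 P Q : Q \is 3.-homog -> formQ (form3 P Q) = Q.
Proof. exact: pihomog_dE. Qed.

Lemma V3_eq w w' : formP w = formP w' -> formQ w = formQ w' -> w = w'.
Proof.
by move=> hP hQ; apply: injective_projections; apply: val_inj.
Qed.

Definition pull_coef alpha q beta r (i : 'I_3) : {mpoly C[3]} :=
  conic alpha * (conic q)^`M(i) + conic beta * (conic r)^`M(i).

(** The form [alpha dq + beta dr]. *)
Definition pull alpha q beta r : V3 C :=
  form3 (pull_coef alpha q beta r 0) (pull_coef alpha q beta r 1).

Lemma mderiv_conic_homog q i : (conic q)^`M(i) \is 1.-homog.
Proof.
by rewrite mderiv_conic; case: ifP => _; last case: ifP => _;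
  rewrite !dhomogD // dhomogZ // dhomogXU.
Qed.

Lemma pull_coef_homog alpha q beta r i : pull_coef alpha q beta r i \is 3.-homog.
Proof.
by apply: dhomogD; apply: (@dhomogM _ _ _ 2 _ 1);
  rewrite ?conic_homog ?mderiv_conic_homog.
Qed.

Lemma formP_pull alpha q beta r : formP (pull alpha q beta r) =
  pull_coef alpha q beta r 0.
Proof. exact/formP_form3/pull_coef_homog. Qed.

Lemma formQ_pull alpha q beta r : formQ (pull alpha q beta r) =
  pull_coef alpha q beta r 1.
Proof. exact/formQ_form3/pull_coef_homog. Qed.

Lemma pullC alpha q beta r : pull alpha q beta r = pull beta r alpha q.
Proof. by rewrite /pull /pull_coef addrC [X in form3 _ X]addrC. Qed.

Lemma mderiv_qaff e0 e1 e2 q r i : i != 2%:R ->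
  (conic (qaff e0 e1 e2 q r))^`M(i)
  = e1 *: (conic q)^`M(i) + e2 *: (conic r)^`M(i).
Proof.
move=> i2; rewrite conic_qaff !mderivD !mderivZ expr2 mderivM mderivXU.
have -> : (2%:R == i) = false by rewrite eq_sym; exact: negPf.
by rewrite mpolyC0 mul0r mulr0 addr0 scaler0 add0r.
Qed.

(** The chain rule for [d(e0 + e1 q + e2 r)]. Since only the [x]- and
    [y]-derivatives enter, the constant [e0 z^2] disappears; this lemma performs
    all the affine changes of coordinates in the target of [(q, r)]. *)
Lemma pull_chain gamma delta e0 e1 e2 d0 d1 d2 q r :
  pull gamma (qaff e0 e1 e2 q r) delta (qaff d0 d1 d2 q r)
  = pull (qlin e1 gamma d1 delta) q (qlin e2 gamma d2 delta) r.
Proof.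
have chain i : i != 2%:R ->
    pull_coef gamma (qaff e0 e1 e2 q r) delta (qaff d0 d1 d2 q r) i
    = pull_coef (qlin e1 gamma d1 delta) q (qlin e2 gamma d2 delta) r i.
  move=> i2; rewrite /pull_coef !mderiv_qaff // !conic_qlin -!mul_mpolyC; ring.
by rewrite /pull !chain.
Qed.

Lemma pull_polyc (alpha q beta r : C -> quad C) :
  qpolyc alpha -> qpolyc q -> qpolyc beta -> qpolyc r ->
  mpolyc (fun t => formP (pull (alpha t) (q t) (beta t) (r t))) /\
  mpolyc (fun t => formQ (pull (alpha t) (q t) (beta t) (r t))).
Proof.
move=> ha hq hb hr.
have coefc i : mpolyc (fun t => pull_coef (alpha t) (q t) (beta t) (r t) i).
  by apply: mpolycD; apply: mpolycM; do ?apply: mpolyc_deriv; exact: conic_polyc.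
by split=> m; [have := coefc 0 m | have := coefc 1 m]; apply: polyc_ext => t;
  rewrite ?formP_pull ?formQ_pull.
Qed.

Lemma meval_mderiv2_conic q (v : 'I_3 -> C) i j :
  (conic q)^`M(i)^`M(j).@[v] =
   if i == 0 then if j == 0 then 2 * qxx q else if j == 1 then qxy q else qxz q
   else if i == 1 then if j == 0 then qxy q else if j == 1 then 2 * qyy q else qyz q
   else if j == 0 then qxz q else if j == 1 then qyz q else 2 * qzz q.
Proof.
have j3 : [\/ j = 0, j = 1 | j = 2%:R].
  case: j => [[|[|[|//]]] jlt]; [apply: Or31 | apply: Or32 | apply: Or33];
  exact: val_inj.
rewrite mderiv_conic; case: ifP => _; last case: ifP => _;
rewrite !mderivD !mderivZ !mderivXU !mevalD !mevalZ !mevalC;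
by case: j3 => -> /=; rewrite !mulr0 ?mulr1 ?addr0 ?add0r.
Qed.

Lemma poincare_pull alpha q beta r :
  poincare (pull alpha q beta r) <->
  [/\ qzz alpha * qxz q + qzz beta * qxz r = 0 /\
      qzz alpha * qyz q + qzz beta * qyz r = 0,
      qxz alpha * qxz q + qzz alpha * (2 * qxx q)
        + (qxz beta * qxz r + qzz beta * (2 * qxx r)) = 1 /\
      qyz alpha * qyz q + qzz alpha * (2 * qyy q)
        + (qyz beta * qyz r + qzz beta * (2 * qyy r)) = 1 &
      qyz alpha * qxz q + qzz alpha * qxy q
        + (qyz beta * qxz r + qzz beta * qxy r) = 0 /\
      qxz alpha * qyz q + qzz alpha * qxy q
        + (qxz beta * qyz r + qzz beta * qxy r) = 0].
Proof.
rewrite /poincare formP_pull formQ_pull /pull_coef !mderivD !mderivM !mevalD !mevalM.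
rewrite !meval_mderiv2_conic /= !(meval_conic_dx, meval_conic_dy, meval_conic).
have o0 : origin C 0 0 = 0 by rewrite mxE.
have o1 : origin C 0 1 = 0 by rewrite mxE.
have o2 : origin C 0 2%:R = 1 by rewrite mxE.
rewrite o0 o1 o2 /qdx /qdy /qval.
rewrite !(mulr0, mul0r, addr0, add0r, expr0n, expr1n, mulr1) /=.
by [].
Qed.

(** The logarithmic form [a r dq + b q dr] has both conics as integral curves:
    the cofactors are [b J] and [- a J], where [J] is the Jacobian of [(q, r)]. *)
Lemma X22_pull a q b r : generic_pair q r != 0 ->
  poincare (pull (qaff 0 0 a q r) q (qaff 0 b 0 q r) r) ->
  X22 (pull (qaff 0 0 a q r) q (qaff 0 b 0 q r) r).
Proof.
rewrite /generic_pair !mulf_eq0 !negb_or -!andbA => /and5P[dq dr iq ir].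
move=> /andP[rn0 dn0] hp; split=> //.
have ea : conic (qaff 0 0 a q r) = a%:MP * conic r.
  by rewrite conic_qaff !scale0r ?add0r ?addr0 mul_mpolyC.
have eb : conic (qaff 0 b 0 q r) = b%:MP * conic q.
  by rewrite conic_qaff !scale0r ?add0r ?addr0 mul_mpolyC.
pose J := (conic q)^`M(0) * (conic r)^`M(1) - (conic q)^`M(1) * (conic r)^`M(0).
have hJ c : c%:MP * J \is 2.-homog.
  rewrite mul_mpolyC dhomogZ // /J dhomogD // ?dhomogN;
  by apply: (@dhomogM _ _ _ 1%N _ 1%N); exact: mderiv_conic_homog.
exists (conic q), (conic r); split.
- split; first by split; [exact: conic_homog | exact: smooth_conic_qdet].
  split; first by split=> //; [exact: conic_homog | exact: conic_neq0].
  exists (b%:MP * J); split; first exact: hJ.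
  by rewrite formP_pull formQ_pull /pull_coef ea eb /J; ring.
- split; first by split; [exact: conic_homog | exact: smooth_conic_qdet].
  split; first by split=> //; [exact: conic_homog | exact: conic_neq0].
  exists (- a%:MP * J); split; first by rewrite -rmorphN; exact: hJ.
  by rewrite formP_pull formQ_pull /pull_coef ea eb /J; ring.
- by split; exact: not_tangent_infinity.
- exact: not_tangent.
- exact: not_common_infinity.
Qed.

End Pullback.

(** * The two families of normal forms *)

Section Families.
Variable C : numClosedFieldType.
Implicit Types (q r : quad C) (w : V3 C).

(** A conic through the origin whose linear part is the isotropic form
    [x + i y]. *)
Definition node_quad (i a b c : C) : quad C := Quad a b c 1 i 0.

Lemma poincare_node i a b c a' b' c' : i ^+ 2 = -1 ->
  let q := node_quad i a b c in let r := node_quad (- i) a' b' c' in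
  poincare (pull (qaff 0 0 2^-1 q r) q (qaff 0 2^-1 0 q r) r).
Proof.
move=> i2 q r; apply/poincare_pull; rewrite /q /r /=.
have two : (2 : C) != 0 by rewrite pnatr_eq0.
split; split; try by field.
transitivity (- i ^+ 2); first by field.
by rewrite i2 opprK.
Qed.

(** The forms [d(q r) / 2], where the linear parts of [q] and [r] multiply to
    [x^2 + y^2], are parametrized by the six coefficients of the quadratic
    parts. *)
Lemma node_closure i a b c a' b' c' : i ^+ 2 = -1 ->
  let q := node_quad i a b c in let r := node_quad (- i) a' b' c' in
  zariski_closure (@X22 C) (pull (qaff 0 0 2^-1 q r) q (qaff 0 2^-1 0 q r) r).
Proof.
move=> i2 q0 r0.
(* With X = x + i y and Y = x - i y these are X + Y^2 - X^2 - XY and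
   Y + X^2 - Y^2 - XY, whose pencil has determinant proportional to mu^3 - 1. *)
pose q1 := node_quad i (-1) (- 4 * i) (-1).
pose r1 := node_quad (- i) (-1) (4 * i) (-1).
pose q t := qlin (1 - t) q0 t q1.
pose r t := qlin (1 - t) r0 t r1.
have -> : q0 = q 0.
  by rewrite /q /qlin subr0 !mul0r !mul1r !addr0.
have -> : r0 = r 0.
  by rewrite /r /qlin subr0 !mul0r !mul1r !addr0.
pose w t := pull (qaff 0 0 2^-1 (q t) (r t)) (q t) (qaff 0 2^-1 0 (q t) (r t)) (r t).
have qp : qpolyc q by apply: qlin_polyc; do ?[split; split]; polyc.
have rp : qpolyc r by apply: qlin_polyc; do ?[split; split]; polyc.
have [] := @pull_polyc _ (fun t => qaff 0 0 2^-1 (q t) (r t)) q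
  (fun t => qaff 0 2^-1 0 (q t) (r t)) r => //.
- by apply: qaff_polyc; polyc.
- by apply: qaff_polyc; polyc.
move=> hP hQ.
apply: (zariski_limit (w := w) (g := fun t => generic_pair (q t) (r t))) => //.
- exact: generic_pair_polyc.
- have -> : q 1 = q1 by rewrite /q /qlin subrr !mul0r !mul1r !add0r.
  have -> : r 1 = r1 by rewrite /r /qlin subrr !mul0r !mul1r !add0r.
  rewrite /generic_pair.
  have -> : qdet q1 = 4 by rewrite /qdet /=; ring: i2.
  have -> : qdet r1 = 4 by rewrite /qdet /=; ring: i2.
  have -> : disc_inf q1 = - 20 by rewrite /disc_inf /=; ring: i2.
  have -> : disc_inf r1 = - 20 by rewrite /disc_inf /=; ring: i2.
  have -> : res_inf q1 r1 = - 64 by rewrite /res_inf /=; ring: i2.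
  have -> : qmix q1 r1 = 0 by rewrite /qmix /=; ring: i2.
  have -> : qmix r1 q1 = 0 by rewrite /qmix /=; ring: i2.
  have -> : cubic_disc 4 (- 0) 0 (- 4) = - (27 * 16 * 16) :> C.
    by rewrite /cubic_disc; ring.
  by rewrite !mulf_neq0 // ?oppr_eq0 ?mulf_neq0 // pnatr_eq0.
move=> t gt0; apply: zariski_closureS.
have [eq er] : q t = node_quad i ((1 - t) * a + t * (-1)) ((1 - t) * b + t * (- 4 * i))
    ((1 - t) * c + t * (-1))
  /\ r t = node_quad (- i) ((1 - t) * a' + t * (-1)) ((1 - t) * b' + t * (4 * i))
    ((1 - t) * c' + t * (-1)).
  by split; rewrite /q /r /qlin /node_quad /=; congr Quad; ring.
rewrite /w; apply: X22_pull => //.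
by rewrite eq er; exact: poincare_node.
Qed.

(** [(x^2 + y^2 - a (u x + v y)^2) / 2]: the second component that the
    normalization at the origin imposes on a quadratic map with first component
    [u x + v y + ...]. *)
Definition fold_quad (a u v : C) : quad C :=
  Quad ((1 - a * u ^+ 2) / 2) (- (a * u * v)) ((1 - a * v ^+ 2) / 2) 0 0 0.

(** The pull-back of [(a1 U + a2 V) dU + (1 + b1 U + b2 V) dV] by a quadratic
    map whose differential at the origin has rank at most one. *)
Definition foldform (a1 a2 b1 b2 : C) (xx xy yy u v : C) : V3 C :=
  let q := Quad xx xy yy u v 0 in let r := fold_quad a1 u v in
  pull (qaff 0 a1 a2 q r) q (qaff 1 b1 b2 q r) r.

Lemma poincare_foldform a1 a2 b1 b2 xx xy yy u v :
  poincare (foldform a1 a2 b1 b2 xx xy yy u v).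
Proof. by apply/poincare_pull; split; split; rewrite /=; field. Qed.

(** A general affine-linear form in the plane has two invariant lines
    [1 + f1 U + f2 V = 0] and [1 + g1 U + g2 V = 0], and is
    [l g df + m f dg]. The slopes [f1] and [g1] are the roots of
    [T^2 - (b1 - a2) T + (a1 b2 - a2 b1)], whose discriminant is the third
    hypothesis; everything else is rational in them. *)
Lemma split_affine_form (a1 a2 b1 b2 : C) :
  a1 != 0 -> a1 * b2 - a2 * b1 != 0 ->
  (b1 - a2) ^+ 2 - 4 * (a1 * b2 - a2 * b1) != 0 ->
  exists l m f1 f2 g1 g2,
    [/\ l * f1 + m * g1 = 0, l * f2 + m * g2 = 1,
       (l + m) * f1 * g1 = a1 /\ l * g2 * f1 + m * f2 * g1 = a2,
       l * g1 * f2 + m * f1 * g2 = b1 /\ (l + m) * f2 * g2 = b2 &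
       [/\ f1 != 0, g1 != 0, f1 - g1 != 0 & f1 * g2 - f2 * g1 != 0]].
Proof.
set D := a1 * b2 - a2 * b1; set disc := _ - 4 * D => an0 Dn0 discn0.
pose e := sqrtC disc.
have e2 : e ^+ 2 = disc by exact: sqrtCK.
have en0 : e != 0 by rewrite sqrtC_eq0.
have two : (2 : C) != 0 by rewrite pnatr_eq0.
pose f := (b1 - a2 + e) / 2; pose g := (b1 - a2 - e) / 2.
have fgD : f * g = D.
  transitivity (((b1 - a2) ^+ 2 - e ^+ 2) / 4); first by rewrite /f /g; field.
  by rewrite e2 /disc; field.
have fg : f - g != 0 by have -> : f - g = e by rewrite /f /g; field.
have b1E : b1 = f + g + a2 by rewrite /f /g; field.
have b2E : b2 = (f + a2) * (g + a2) / a1.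
  transitivity ((D + a2 * b1) / a1); first by rewrite /D; field.
  by rewrite -fgD {1}b1E; field.
have /andP[fn0 gn0] : (f != 0) && (g != 0) by rewrite -negb_or -mulf_eq0 fgD.
exists (- a1 / (f * (f - g))), (a1 / (g * (f - g))).
exists f, (f * (g + a2) / a1), g, (g * (f + a2) / a1).
rewrite b2E b1E; move: f g fg fn0 gn0 {fgD b1E b2E} => f g fg fn0 gn0.
split; try by field; rewrite ?fn0 ?gn0 ?fg ?an0.
- by split; field; rewrite ?fn0 ?gn0 ?fg ?an0.
- by split; field; rewrite ?fn0 ?gn0 ?fg ?an0.
- split=> //; have -> : f * (g * (f + a2) / a1) - f * (g + a2) / a1 * g
    = f * g * (f - g) / a1 by field.
  by rewrite !mulf_neq0 ?invr_neq0.
Qed.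

Lemma pull_log (l m f1 f2 g1 g2 : C) q r :
  l * f1 + m * g1 = 0 -> l * f2 + m * g2 = 1 ->
  let F := qaff 1 f1 f2 q r in let G := qaff 1 g1 g2 q r in
  pull (qaff 0 0 l F G) F (qaff 0 m 0 F G) G
  = pull (qaff 0 ((l + m) * f1 * g1) (l * g2 * f1 + m * f2 * g1) q r) q
         (qaff 1 (l * g1 * f2 + m * f1 * g2) ((l + m) * f2 * g2) q r) r.
Proof.
move=> h0 h1 F G; rewrite /F /G pull_chain.
congr (pull _ _ _ _); rewrite /qlin /=; congr Quad; try ring.
- by rewrite -[X in _ = X + _ + _]h0; ring.
- by rewrite -[X in _ = X + _ + _]h1; ring.
Qed.

Lemma generic_pair_diag (x1 y1 x2 y2 : C) :
  generic_pair (Quad x1 0 y1 0 0 1) (Quad x2 0 y2 0 0 1)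
  = (4 ^+ 4 * x1 * y1 * x2 * y2) ^+ 2 *
    ((x1 * y2 - x2 * y1) ^+ 2 * (x1 - x2) * (y1 - y2)) ^+ 2.
Proof.
by rewrite /generic_pair /cubic_disc /qmix /qdet /disc_inf /res_inf /=; ring.
Qed.

(** The two conics [1 + f1 U + f2 V] and [1 + g1 U + g2 V] for the diagonal map
    [U = s x^2 + t y^2], [V = (x^2 + y^2) / 2]. All conditions on [s] are that
    it avoids roots of linear polynomials, and [t] moreover differs from [s]. *)
Lemma exists_diag (f1 f2 g1 g2 : C) :
  f1 != 0 -> g1 != 0 -> f1 - g1 != 0 -> f1 * g2 - f2 * g1 != 0 ->
  exists s t, generic_pair
    (Quad (f1 * s + f2 / 2) 0 (f1 * t + f2 / 2) 0 0 1)
    (Quad (g1 * s + g2 / 2) 0 (g1 * t + g2 / 2) 0 0 1) != 0.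
Proof.
move=> fn0 gn0 fg dn0.
have lin (a b : C) : a != 0 -> a *: 'X + b%:P != 0.
  move=> an0; apply/eqP => /(congr1 (fun p : {poly C} => p`_1)).
  rewrite coefD coefZ coefX coefC coef0 /= mulr1 addr0 => e.
  by rewrite e eqxx in an0.
pose p := (f1 *: 'X + (f2 / 2)%:P) * (g1 *: 'X + (g2 / 2)%:P)
  * ((f1 - g1) *: 'X + ((f2 - g2) / 2)%:P).
have pn0 : p != 0 by rewrite !mulf_neq0 // lin.
have [s] := exists_nonroot pn0.
rewrite /p !hornerM !hornerD !hornerZ !hornerX !hornerC !mulf_eq0 !negb_or.
move=> /andP[/andP[s1 s2] s3].
have [t] : exists t, (p * (1 *: 'X + (- s)%:P)).[t] != 0.
  by apply: exists_nonroot; rewrite mulf_neq0 // lin // oner_eq0.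
rewrite /p !hornerM !hornerD !hornerZ !hornerX !hornerC !mulf_eq0 !negb_or mul1r.
move=> /andP[/andP[/andP[t1 t2] t3] t4].
exists s, t; rewrite generic_pair_diag.
have -> : (f1 * s + f2 / 2) * (g1 * t + g2 / 2)
          - (g1 * s + g2 / 2) * (f1 * t + f2 / 2)
        = - ((f1 * g2 - f2 * g1) * (t - s)) / 2 by field.
have -> : (f1 * s + f2 / 2) - (g1 * s + g2 / 2)
   = (f1 - g1) * s + (f2 - g2) / 2 by field.
have -> : (f1 * t + f2 / 2) - (g1 * t + g2 / 2)
   = (f1 - g1) * t + (f2 - g2) / 2 by field.
by rewrite !(mulf_neq0, expf_neq0, invr_neq0, oppr_eq0) // pnatr_eq0.
Qed.

(** When the form on the target splits, the first component of the quadratic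
    map is moved along a line to a diagonal quadratic form; the target form, and
    hence the shape [l G dF + m F dG], does not change on the way. *)
Lemma foldform_closure_split a1 a2 b1 b2 xx xy yy u v :
  a1 != 0 -> a1 * b2 - a2 * b1 != 0 ->
  (b1 - a2) ^+ 2 - 4 * (a1 * b2 - a2 * b1) != 0 ->
  zariski_closure (@X22 C) (foldform a1 a2 b1 b2 xx xy yy u v).
Proof.
move=> an0 Dn0 discn0.
have [l [m [f1 [f2 [g1 [g2 [h0 h1 [a1E a2E] [b1E b2E] [fn0 gn0 fg dn0]]]]]]]] :=
  split_affine_form an0 Dn0 discn0.
have [s1 [s2 gen]] := exists_diag fn0 gn0 fg dn0.
pose q t := Quad ((1 - t) * xx + t * s1) ((1 - t) * xy) ((1 - t) * yy + t * s2)
                 ((1 - t) * u) ((1 - t) * v) 0.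
pose r t := fold_quad a1 ((1 - t) * u) ((1 - t) * v).
pose w t := foldform a1 a2 b1 b2 ((1 - t) * xx + t * s1) ((1 - t) * xy)
  ((1 - t) * yy + t * s2) ((1 - t) * u) ((1 - t) * v).
pose F t := qaff 1 f1 f2 (q t) (r t); pose G t := qaff 1 g1 g2 (q t) (r t).
have -> : foldform a1 a2 b1 b2 xx xy yy u v = w 0.
  by rewrite /w subr0 !mul0r !mul1r !addr0.
have qp : qpolyc q by split; split; rewrite /=; polyc.
have rp : qpolyc r by split; split; rewrite /=; polyc.
have Fp : qpolyc F by apply: qaff_polyc; polyc.
have Gp : qpolyc G by apply: qaff_polyc; polyc.
have [] := @pull_polyc _ (fun t => qaff 0 a1 a2 (q t) (r t)) q
  (fun t => qaff 1 b1 b2 (q t) (r t)) r => //; try by apply: qaff_polyc; polyc.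
move=> hP hQ.
apply: (zariski_limit (w := w) (g := fun t => generic_pair (F t) (G t))) => //.
- exact: generic_pair_polyc.
- have -> : F 1 = Quad (f1 * s1 + f2 / 2) 0 (f1 * s2 + f2 / 2) 0 0 1.
    by rewrite /F /q /r /qaff /=; congr Quad; field.
  have -> : G 1 = Quad (g1 * s1 + g2 / 2) 0 (g1 * s2 + g2 / 2) 0 0 1.
    by rewrite /G /q /r /qaff /=; congr Quad; field.
  exact: gen.
move=> t gt0; apply: zariski_closureS.
have wE : w t = pull (qaff 0 0 l (F t) (G t)) (F t) (qaff 0 m 0 (F t) (G t)) (G t).
  by rewrite pull_log // a1E a2E b1E b2E.
by rewrite wE; apply: X22_pull => //; rewrite -wE; exact: poincare_foldform.
Qed.

(** The remaining target forms are limits of those that split, along the line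
    to [U dU + (1 + V) dV]. *)
Lemma foldform_closure a1 a2 b1 b2 xx xy yy u v :
  zariski_closure (@X22 C) (foldform a1 a2 b1 b2 xx xy yy u v).
Proof.
pose A1 t := (1 - t) * a1 + t; pose A2 t := (1 - t) * a2.
pose B1 t := (1 - t) * b1; pose B2 t := (1 - t) * b2 + t.
pose w t := foldform (A1 t) (A2 t) (B1 t) (B2 t) xx xy yy u v.
have -> : foldform a1 a2 b1 b2 xx xy yy u v = w 0.
  by rewrite /w /A1 /A2 /B1 /B2 subr0 !mul1r !addr0.
have [A1p A2p] : polyc A1 /\ polyc A2 by split; rewrite /A1 /A2; polyc.
have [B1p B2p] : polyc B1 /\ polyc B2 by split; rewrite /B1 /B2; polyc.
pose q := Quad xx xy yy u v 0; pose r t := fold_quad (A1 t) u v.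
have qp : qpolyc (fun=> q) by split; split; polyc.
have rp : qpolyc r by split; split; rewrite /=; polyc.
have [] := @pull_polyc _ (fun t => qaff 0 (A1 t) (A2 t) q (r t)) (fun=> q)
  (fun t => qaff 1 (B1 t) (B2 t) q (r t)) r => //; try by apply: qaff_polyc; polyc.
move=> hP hQ.
apply: (zariski_limit (w := w) (g := fun t => A1 t *
  (A1 t * B2 t - A2 t * B1 t) *
  ((B1 t - A2 t) ^+ 2 - 4 * (A1 t * B2 t - A2 t * B1 t)))) => //.
- by polyc.
- have -> : A1 1 * (A1 1 * B2 1 - A2 1 * B1 1) *
    ((B1 1 - A2 1) ^+ 2 - 4 * (A1 1 * B2 1 - A2 1 * B1 1)) = - 4.
    by rewrite /A1 /A2 /B1 /B2; ring.
  by rewrite oppr_eq0 pnatr_eq0.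
move=> t; rewrite !mulf_eq0 !negb_or => /andP[/andP[h1 h2] h3].
exact: foldform_closure_split.
Qed.

End Families.

(** * Reduction of Poincare pull-backs to the normal forms *)

Section NormalForms.
Variable C : numClosedFieldType.
Implicit Types (q r : quad C) (w : V3 C).

(** The pull-back of [(e0 + e1 U + e2 V) dU + (d0 + d1 U + d2 V) dV] by the
    quadratic map [(U, V) = (q, r)]. *)
Definition pencil (e0 e1 e2 d0 d1 d2 : C) q r : V3 C :=
  pull (qaff e0 e1 e2 q r) q (qaff d0 d1 d2 q r) r.

Lemma binary_quadratic_split (a b c : C) :
  exists f1 f2 g1 g2, [/\ f1 * g1 = a, f1 * g2 + f2 * g1 = 2 * b & f2 * g2 = c].
Proof.
have [->|an0] := eqVneq a 0.
  by exists 0, 1, (2 * b), c; split; ring.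
pose s := sqrtC (b ^+ 2 - a * c).
have s2 : s ^+ 2 = b ^+ 2 - a * c by exact: sqrtCK.
exists a, (b + s), 1, ((b - s) / a); split; [by ring | by field |].
transitivity ((b ^+ 2 - s ^+ 2) / a); first by field.
by rewrite s2; field.
Qed.

(** The singular point of the target form is the image of the origin. The
    linear part of the pull-back is nondegenerate, hence the map is a local
    isomorphism at the origin; its symmetry then forces the target form to be
    closed, so that it is half the differential of a quadratic form. That form
    is a product of two linear ones, which are rescaled to have the linear parts
    [x + i y] and [x - i y]. *)
Lemma pencil_node e1 e2 d1 d2 q r : qzz q = 0 -> qzz r = 0 ->
  poincare (pencil 0 e1 e2 0 d1 d2 q r) ->
  zariski_closure (@X22 C) (pencil 0 e1 e2 0 d1 d2 q r).
Proof.
case: q => qa qb qc x y _ /= ->; case: r => ra rb rc x' y' _ /= ->.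
move=> hp; have /poincare_pull /= := hp.
rewrite !(mulr0, addr0, add0r, mul0r) => -[_ [hxx hyy] [hxy hyx]].
have det1 : (e1 * d2 - e2 * d1) * (x * y' - x' * y) ^+ 2 = 1.
  transitivity (
      ((e1 * x + e2 * x') * x + (d1 * x + d2 * x') * x')
    * ((e1 * y + e2 * y') * y + (d1 * y + d2 * y') * y')
    - ((e1 * y + e2 * y') * x + (d1 * y + d2 * y') * x')
    * ((e1 * x + e2 * x') * y + (d1 * x + d2 * x') * y')); first by ring.
  by rewrite hxx hyy hxy hyx mulr1 mulr0 subr0.
have ed : e2 = d1.
  have dn0 : x * y' - x' * y != 0.
    by apply: contra_eq_neq det1 => ->; rewrite expr0n mulr0 eq_sym oner_neq0.
  apply/eqP; rewrite -subr_eq0; apply/eqP; apply: (mulfI dn0).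
  transitivity ((e1 * y + e2 * y') * x + (d1 * y + d2 * y') * x'
    - ((e1 * x + e2 * x') * y + (d1 * x + d2 * x') * y')); first by ring.
  by rewrite hxy hyx subrr mulr0.
subst d1.
have [f1 [f2 [g1 [g2 [h1 h2 h3]]]]] := binary_quadratic_split e1 e2 d2.
have e2E : e2 = (f1 * g2 + f2 * g1) / 2 by rewrite h2; field.
pose p := f1 * x + f2 * x'; pose p' := f1 * y + f2 * y'.
pose s := g1 * x + g2 * x'; pose s' := g1 * y + g2 * y'.
have ps : p * s = 1 by rewrite -hxx -h1 -h3 /p /s e2E; field.
have ps' : p' * s' = 1 by rewrite -hyy -h1 -h3 /p' /s' e2E; field.
have mix : p * s' + p' * s = 0.
  transitivity ((e1 * y + e2 * y') * x + (e2 * y + d2 * y') * x'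
    + ((e1 * x + e2 * x') * y + (e2 * x + d2 * x') * y')).
    by rewrite -h1 -h3 /p /p' /s /s' e2E; field.
  by rewrite hxy hyx addr0.
have pn0 : p != 0 by apply: contra_eq_neq ps => ->; rewrite mul0r eq_sym oner_neq0.
have pn0' : p' != 0 by apply: contra_eq_neq ps' => ->; rewrite mul0r eq_sym oner_neq0.
have sE : s = p^-1 by apply: (mulfI pn0); rewrite ps mulfV.
have sE' : s' = p'^-1 by apply: (mulfI pn0'); rewrite ps' mulfV.
(* The linear parts are p x + p' y and s x + s' y, with product x^2 + y^2. *)
have i2 : (p' / p) ^+ 2 = -1.
  apply/eqP; rewrite -addr_eq0; apply/eqP.
  transitivity (p' / p * (p * s' + p' * s)); last by rewrite mix mulr0.
  by rewrite sE sE'; field; rewrite pn0 pn0'.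
have := node_closure (f1 / p * qa + f2 / p * ra) (f1 / p * qb + f2 / p * rb)
  (f1 / p * qc + f2 / p * rc) (g1 * p * qa + g2 * p * ra)
  (g1 * p * qb + g2 * p * rb) (g1 * p * qc + g2 * p * rc) i2.
cbv zeta.
set q := Quad qa qb qc x y 0; set r := Quad ra rb rc x' y' 0.
have <- : qaff 0 (f1 / p) (f2 / p) q r = node_quad (p' / p)
   (f1 / p * qa + f2 / p * ra) (f1 / p * qb + f2 / p * rb)
   (f1 / p * qc + f2 / p * rc).
  rewrite /qaff /node_quad /=; congr Quad; last by ring.
    by rewrite -(mulfV pn0) {3}/p; field.
  by rewrite /p'; field.
have <- : qaff 0 (g1 * p) (g2 * p) q r = node_quad (- (p' / p))
   (g1 * p * qa + g2 * p * ra) (g1 * p * qb + g2 * p * rb)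
   (g1 * p * qc + g2 * p * rc).
  rewrite /qaff /node_quad /=; congr Quad; last by ring.
    by rewrite -ps /s; ring.
  apply: (mulIf (invr_neq0 pn0)); transitivity (s'); first by rewrite /s'; field.
  transitivity (- (p' * s) / p); last by rewrite sE; field.
  have -> : - (p' * s) = p * s' by apply/eqP; rewrite eq_sym -addr_eq0 mix.
  by field.
rewrite pull_chain /pencil; congr (zariski_closure _ (pull _ _ _ _)).
- by rewrite /qlin /qaff /=; congr Quad; rewrite -?h1 -?h3 ?e2E; field.
- by rewrite /qlin /qaff /=; congr Quad; rewrite -?h1 -?h3 ?e2E; field.
Qed.

(** The target form does not vanish at the image of the origin, so the vanishing
    of the pull-back there kills the linear part of [e0 q + d0 r]; this quadric
    is taken as the new second component. *)
Lemma pencil_fold e0 e1 e2 d0 d1 d2 q r : d0 != 0 -> qzz q = 0 -> qzz r = 0 ->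
  poincare (pencil e0 e1 e2 d0 d1 d2 q r) ->
  zariski_closure (@X22 C) (pencil e0 e1 e2 d0 d1 d2 q r).
Proof.
move=> dn0.
case: q => qa qb qc x y _ /= ->; case: r => ra rb rc x' y' _ /= -> hp.
set q := Quad qa qb qc x y 0 in hp *; set r := Quad ra rb rc x' y' 0 in hp *.
pose k := e0 / d0.
pose A1 := e1 - k * e2 - k * (d1 - k * d2).
pose A2 := (e2 - k * d2) / d0.
pose B1 := (d1 - k * d2) / d0; pose B2 := d2 / d0 ^+ 2.
have pE : pencil e0 e1 e2 d0 d1 d2 q r
        = pencil 0 A1 A2 1 B1 B2 q (qaff 0 e0 d0 q r).
  rewrite /pencil; set r' := qaff 0 e0 d0 q r.
  have {2}-> : q = qaff 0 1 0 q r' by rewrite /qaff /=; congr Quad; ring.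
  have {3}-> : r = qaff 0 (- k) d0^-1 q r'.
    by rewrite /qaff /=; congr Quad; rewrite /k; field.
  rewrite pull_chain; congr (pull _ _ _ _);
  by rewrite /qlin /qaff /=; congr Quad; rewrite /A1 /A2 /B1 /B2 /k; field.
rewrite pE in hp *.
have [[hx hy] [hxx hyy] [hxy hyx]] := (poincare_pull _ _ _ _).1 hp.
have rE : qaff 0 e0 d0 q r = fold_quad A1 x y.
  move: hx hy hxx hyy hxy hyx; rewrite /=.
  rewrite !(mulr0, mul0r, addr0, add0r, mul1r).
  move=> hx hy; rewrite hx hy !(mulr0, addr0) => hxx hyy hxy hyx.
  have two : (2 : C) != 0 by rewrite pnatr_eq0.
  rewrite /qaff /fold_quad /=; congr Quad => //; last by rewrite !mulr0 !addr0.
  - by rewrite -{1}hxx; field.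
  - by apply/eqP; rewrite -addr_eq0 addrC -hyx; apply/eqP; ring.
  - by rewrite -{1}hyy; field.
rewrite rE; exact: foldform_closure.
Qed.

Lemma poincare_pencil_closure e0 e1 e2 d0 d1 d2 q r :
  poincare (pencil e0 e1 e2 d0 d1 d2 q r) ->
  zariski_closure (@X22 C) (pencil e0 e1 e2 d0 d1 d2 q r).
Proof.
wlog [q0 r0] : e0 d0 q r / qzz q = 0 /\ qzz r = 0.
  move=> H hp.
  (* Translating the target moves the image of the origin to 0. *)
  pose q' := Quad (qxx q) (qxy q) (qyy q) (qxz q) (qyz q) 0.
  pose r' := Quad (qxx r) (qxy r) (qyy r) (qxz r) (qyz r) 0.
  have E : pencil e0 e1 e2 d0 d1 d2 q r =
    pencil (e0 + e1 * qzz q + e2 * qzz r) e1 e2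
           (d0 + d1 * qzz q + d2 * qzz r) d1 d2 q' r'.
    rewrite /pencil.
    have {2}-> : q = qaff (qzz q) 1 0 q' r'.
      by rewrite /q' /r' /qaff /=; case: (q) => * /=; congr Quad; ring.
    have {3}-> : r = qaff (qzz r) 0 1 q' r'.
      by rewrite /q' /r' /qaff /=; case: (r) => * /=; congr Quad; ring.
    by rewrite pull_chain; congr (pull _ _ _ _); rewrite /qlin /qaff /=; congr Quad; ring.
  by rewrite E in hp *; exact: H.
move=> hp.
have [dz|dn0] := eqVneq d0 0; last exact: pencil_fold.
have [ez|en0] := eqVneq e0 0; first by subst d0 e0; exact: pencil_node.
have swap : pencil e0 e1 e2 d0 d1 d2 q r = pencil d0 d2 d1 e0 e2 e1 r q.
  by rewrite /pencil pullC; congr (pull _ _ _ _); rewrite /qaff; congr Quad; ring.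
by rewrite swap in hp *; exact: pencil_fold.
Qed.

End NormalForms.

(** * Homogenization *)

Section Homogenize.
Variable C : numClosedFieldType.

(** The affine chart [z = 1]. *)
Definition chart : 3.-tuple {mpoly C[2]} := [tuple 'X_0; 'X_1; 1].

Lemma homogenize_is_linear d : linear (@homogenize C d).
Proof.
move=> a p q; rewrite /homogenize scaler_sumr -big_split /=.
by apply: eq_bigr => m _; rewrite mcoeffD mcoeffZ scalerDl scalerA.
Qed.

HB.instance Definition _ d := GRing.isLinear.Build C {mpoly C[2]} {mpoly C[3]} _
  (@homogenize C d) (@homogenize_is_linear d).

Lemma homogenize_chart d (H : {mpoly C[3]}) :
  H \is d.-homog -> homogenize d (H \mPo chart) = H.
Proof.
move=> /dhomogP homH; rewrite [in RHS](mpolyE H) [in LHS](mpolyE H).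
rewrite (raddf_sum (comp_mpoly chart)) raddf_sum.
apply: eq_big_seq => m /homH /= degm; rewrite comp_mpolyZ linearZ /=; congr (_ *: _).
have deg3 : (m 0%R + m 1%R + m (2%:R)%R)%N = d.
  rewrite -degm mdegE !big_ord_recl big_ord0 addn0 addnA.
  by congr (m _ + m _ + m _)%N; apply: val_inj.
pose m' : 'X_{1..2} := [multinom [tuple m 0; m 1]].
have deg2 : mdeg m' = (m 0%R + m 1%R)%N.
  by rewrite mdegE !big_ord_recl big_ord0 addn0 !multinomE.
have -> : 'X_[m] \mPo chart = 'X_[m'].
  rewrite comp_mpolyX [in RHS]mpolyXE_id !big_ord_recl !big_ord0 /= !multinomE.
  rewrite /tnth /= expr1n !mulr1.
  by congr ('X__ ^+ m _ * 'X__ ^+ m _); apply: val_inj.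
have ltm' : (mdeg m' < d.+1)%N by rewrite deg2 ltnS -deg3 leq_addr.
rewrite /homogenize (bigD1 (BMultinom ltm')) //= mcoeffX eqxx scale1r.
rewrite big1 ?addr0; last first.
  move=> k km; rewrite mcoeffX; case: eqP => [e|_]; last by rewrite scale0r.
  by case/eqP: km; apply: val_inj.
congr 'X_[_]; apply/mnmP => -[[|[|[|//]]] ilt]; rewrite multinomE (tnth_nth 0%N) /=.
- by rewrite multinomE; congr (m _); apply: val_inj.
- by rewrite multinomE; congr (m _); apply: val_inj.
- by rewrite deg2 -deg3 addKn; congr (m _); apply: val_inj.
Qed.

End Homogenize.

(** * The CR7 family *)

Section CR7.
Variable C : numClosedFieldType.

Section AffineChange.
Variables (A : 'M[C]_2) (b : 'cV[C]_2) (c : C).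

(** The quadratic map [(X Y, X (X + Y + c))] in the affine coordinates
    [X, Y] given by [A] and [b], homogenized. *)
Definition qU : quad C :=
  Quad (A 0 0 * A 1 0) (A 0 0 * A 1 1 + A 0 1 * A 1 0) (A 0 1 * A 1 1)
       (A 0 0 * b 1 0 + A 1 0 * b 0 0) (A 0 1 * b 1 0 + A 1 1 * b 0 0)
       (b 0 0 * b 1 0).

Definition qV : quad C :=
  let s0 := A 0 0 + A 1 0 in let s1 := A 0 1 + A 1 1 in
  let s2 := b 0 0 + b 1 0 + c in
  Quad (A 0 0 * s0) (A 0 0 * s1 + A 0 1 * s0) (A 0 1 * s1)
       (A 0 0 * s2 + s0 * b 0 0) (A 0 1 * s2 + s1 * b 0 0) (b 0 0 * s2).

Local Notation lam := (tnth (affine_map A b)).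

Lemma affine_mapE i :
  lam i = A i 0 *: 'X_0 + A i 1 *: 'X_1 + (b i 0)%:MP.
Proof.
rewrite /affine_map tnth_mktuple !big_ord_recl big_ord0 addr0.
by congr (A _ _ *: 'X_ _ + A _ _ *: 'X_ _ + _); apply: val_inj.
Qed.

Lemma affine_map_deriv i j : (lam i)^`M(j) = (A i j)%:MP.
Proof.
rewrite affine_mapE !mderivD mderivC !mderivZ !mderivXU addr0.
have [->|->] : j = 0 \/ j = 1.
  by case: j => [[|[|//]] jlt]; [left | right]; exact: val_inj.
  by rewrite /= mpolyC0 mpolyC1 scaler0 addr0 -mul_mpolyC mulr1.
by rewrite /= mpolyC0 mpolyC1 scaler0 add0r -mul_mpolyC mulr1.
Qed.

Lemma chart_X (i : 'I_3) : ('X_i : {mpoly C[3]}) \mPo chart C = tnth (chart C) i.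
Proof. by rewrite comp_mpolyXU -tnth_nth. Qed.

Lemma chart_qU : conic qU \mPo chart C = lam 0 * lam 1.
Proof.
rewrite conicE !rmorphD /= !linearZ /= !rmorphXn !rmorphM /= !chart_X !affine_mapE.
rewrite /chart /tnth /= -!mul_mpolyC !(rmorphD, rmorphM) /=; ring.
Qed.

Lemma chart_qV : conic qV \mPo chart C = lam 0 * (lam 0 + lam 1 + c%:MP).
Proof.
rewrite conicE !rmorphD /= !linearZ /= !rmorphXn !rmorphM /= !chart_X !affine_mapE.
rewrite /chart /tnth /= -!mul_mpolyC !(rmorphD, rmorphM) /=; ring.
Qed.

End AffineChange.

Lemma chart_qaff e0 e1 e2 q r :
  conic (qaff e0 e1 e2 q r) \mPo chart C
  = e0%:MP + e1%:MP * (conic q \mPo chart C) + e2%:MP * (conic r \mPo chart C).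
Proof.
rewrite conic_qaff !comp_mpolyD !comp_mpolyZ rmorphXn /= -!mul_mpolyC.
by rewrite chart_X /chart /tnth /= expr1n mulr1.
Qed.

Lemma chart_deriv q (i : 'I_3) (j : 'I_2) : i = j :> nat ->
  (conic q)^`M(i) \mPo chart C = (conic q \mPo chart C)^`M(j).
Proof.
have [-> e | -> e] : j = 0 \/ j = 1.
  by case: j => [[|[|//]] jlt]; [left | right]; exact: val_inj.
  have -> : i = 0 by apply: val_inj.
  rewrite mderiv_conic conicE !rmorphD /= !linearZ /= !rmorphXn !rmorphM /= !chart_X.
  rewrite /chart /tnth /= !mderivD !mderivZ !expr2 !mderivM !mderivXU -mpolyC1 mderivC.
  by rewrite -!mul_mpolyC !rmorphM /= ?mpolyC0 ?mpolyC1 ?rmorph_nat; ring.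
have -> : i = 1 by apply: val_inj.
rewrite mderiv_conic conicE !rmorphD /= !linearZ /= !rmorphXn !rmorphM /= !chart_X.
rewrite /chart /tnth /= !mderivD !mderivZ !expr2 !mderivM !mderivXU -mpolyC1 mderivC.
by rewrite -!mul_mpolyC !rmorphM /= ?mpolyC0 ?mpolyC1 ?rmorph_nat; ring.
Qed.

(** Zoladek's form is the pull-back of
    [- (k + l V) dU + (- n + (l - m) U - p V) dV] by
    [(U, V) = (x y, x (x + y + c))]. *)
Lemma homogenize_CR7 A b c k l m n p :
  homogenize_form (pullback (affine_map A b) (CR7 c k l m n p))
  = pencil (- k) 0 (- l) (- n) (l - m) (- p) (qU A b) (qV A b c).
Proof.
have key (i : 'I_3) (j : 'I_2) : i = j :> nat ->
    ((CR7 c k l m n p).1 \mPo affine_map A b) * (tnth (affine_map A b) 0)^`M(j)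
    + ((CR7 c k l m n p).2 \mPo affine_map A b) * (tnth (affine_map A b) 1)^`M(j)
    = pull_coef (qaff (- k) 0 (- l) (qU A b) (qV A b c)) (qU A b)
        (qaff (- n) (l - m) (- p) (qU A b) (qV A b c)) (qV A b c) i \mPo chart C.
  move=> ij; rewrite /pull_coef rmorphD !rmorphM /= !chart_qaff !(chart_deriv _ ij).
  rewrite chart_qU chart_qV !mderivM !mderivD mderivC !affine_map_deriv /CR7 /=.
  pose l0 := tnth (affine_map A b) 0; pose l1 := tnth (affine_map A b) 1.
  have e0 : ('X_0 : {mpoly C[2]}) \mPo affine_map A b = l0.
    by rewrite comp_mpolyXU -tnth_nth.
  have e1 : ('X_1 : {mpoly C[2]}) \mPo affine_map A b = l1.
    by rewrite comp_mpolyXU -tnth_nth.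
  rewrite -/l0 -/l1.
  rewrite !(comp_mpolyN, comp_mpolyB, comp_mpolyD, comp_mpolyZ, comp_mpolyC).
  rewrite !(rmorphM (comp_mpoly _), rmorphXn (comp_mpoly _)) /=.
  rewrite !(comp_mpolyN, comp_mpolyB, comp_mpolyD, comp_mpolyZ, comp_mpolyC).
  rewrite e0 e1.
  by rewrite -!mul_mpolyC !(mpolyCN, mpolyCB, mpolyCD, mpolyC0); ring.
apply: V3_eq.
- rewrite /pencil formP_pull -[RHS](homogenize_chart (pull_coef_homog _ _ _ _ _)).
  by rewrite -(key 0 0).
- rewrite /pencil formQ_pull -[RHS](homogenize_chart (pull_coef_homog _ _ _ _ _)).
  by rewrite -(key 1 1).
Qed.

Lemma X_CR7_closure w : X_CR7 w -> zariski_closure (@X22 C) w.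
Proof.
move=> [[c [k [l [m [n [p [A [b [_ ->]]]]]]]]]].
by rewrite homogenize_CR7; exact: poincare_pencil_closure.
Qed.

Lemma pullback_id (w : aform C) : pullback (affine_map 1%:M 0) w = w.
Proof.
have -> : affine_map 1%:M 0 = [tuple ('X_i : {mpoly C[2]}) | i < 2].
  apply: eq_from_tnth => i; rewrite tnth_mktuple affine_mapE !mxE mpolyC0 addr0.
  have [->|->] : i = 0 \/ i = 1.
    by case: i => [[|[|//]] ilt]; [left | right]; exact: val_inj.
    by rewrite !eqxx /= scale1r scale0r addr0.
  by rewrite !eqxx /= scale1r scale0r add0r.
case: w => P Q; rewrite /pullback /= !comp_mpoly_id !tnth_mktuple !mderivXU /=.
by rewrite mpolyC0 mpolyC1 !mulr0 !mulr1 addr0 add0r.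
Qed.

Definition jac q r : {mpoly C[3]} :=
  (conic q)^`M(0) * (conic r)^`M(1) - (conic q)^`M(1) * (conic r)^`M(0).

Lemma jac_homog q r a : a *: jac q r \is 2.-homog.
Proof.
apply: dhomogZ; rewrite /jac dhomogD // ?dhomogN;
by apply: (@dhomogM _ _ _ 1%N _ 1%N); exact: mderiv_conic_homog.
Qed.

(** The exterior derivative of an affine-linear form is constant, so that of the
    pull-back is a multiple of the Jacobian. *)
Lemma curl_pencil e0 e1 e2 d0 d1 d2 q r :
  let w := pencil e0 e1 e2 d0 d1 d2 q r in
  (formQ w)^`M(0) - (formP w)^`M(1) = (d1 - e2) *: jac q r.
Proof.
rewrite /pencil formP_pull formQ_pull /pull_coef !mderivD !mderivM !mderiv_qaff //.
rewrite (mderiv_comm 0 1 (conic q)) (mderiv_comm 0 1 (conic r)) /jac.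
by rewrite -!mul_mpolyC !rmorphB /=; ring.
Qed.

(** The hypotheses say that the line [g0 + g1 U + g2 V = 0] is invariant for the
    target form, with constant cofactor; its preimage is then invariant for the
    pull-back, with cofactor proportional to the Jacobian. *)
Lemma cofactor_pencil (e0 e1 e2 d0 d1 d2 g0 g1 g2 s : C) q r :
  e0 * g2 - d0 * g1 = - s * g0 -> e1 * g2 - d1 * g1 = - s * g1 ->
  e2 * g2 - d2 * g1 = - s * g2 ->
  Defs.cofactor (pencil e0 e1 e2 d0 d1 d2 q r) (conic (qaff g0 g1 g2 q r))
    (s *: jac q r).
Proof.
move=> h0 h1 h2; split; first exact: jac_homog.
rewrite /pencil formP_pull formQ_pull /pull_coef !mderiv_qaff // /jac.
transitivity (((e0 * g2 - d0 * g1) *: 'X_(2%:R) ^+ 2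
  + (e1 * g2 - d1 * g1) *: conic q + (e2 * g2 - d2 * g1) *: conic r) * jac q r).
  rewrite !conic_qaff /jac -!mul_mpolyC !(rmorphB, rmorphM) /=; ring.
rewrite h0 h1 h2 !conic_qaff /jac -!mul_mpolyC !(rmorphN, rmorphM) /=; ring.
Qed.

Lemma CR7_pencil (c k l m n p : C) : exists q r,
  [/\ homogenize_form (CR7 c k l m n p) = pencil (- k) 0 (- l) (- n) (l - m) (- p) q r,
      homogenize 2 (CR7_conic c k l m n p) =
        conic (qaff (k * p - m * n) ((l - m) * m) ((l - m) * p) q r)
    & qxx q = 0 /\ qxx r = 1].
Proof.
exists (qU 1%:M 0), (qV 1%:M 0 c); split.
- by rewrite -homogenize_CR7 pullback_id.
- rewrite -[RHS](homogenize_chart (conic_homog _)); congr homogenize.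
  rewrite chart_qaff chart_qU chart_qV !affine_mapE !mxE /= !scale0r !scale1r.
  rewrite mpolyC0 !addr0 add0r /CR7_conic.
  by rewrite -!mul_mpolyC !(mpolyCN, mpolyCB, mpolyCD, mpolyCM, rmorphXn) /=; ring.
- by rewrite /= !mxE /= !mulr0 addr0 mulr1.
Qed.

Lemma conic_neq0_xx (q : quad C) : qxx q != 0 -> conic q != 0.
Proof.
apply: contraNneq => /(congr1 (fun F => F.@[fun i => (i == 0)%:R])).
by rewrite meval_conic meval0 /qval /= !(expr0n, expr1n, mulr0, mulr1, addr0) => ->.
Qed.

(** The conic is the preimage of an invariant line, and both its cofactor and
    [Q_x - P_y] are multiples of the Jacobian of the quadratic map; so this one
    curve already gives Darboux integrability. *)
Lemma CR7_integrable (c k l m n p : C) : (l - m) * p != 0 ->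
  let w := homogenize_form (CR7 c k l m n p) in
  integral_curve w 2 (homogenize 2 (CR7_conic c k l m n p)) /\
  darboux_integrable w.
Proof.
move=> lmp0 w.
have [q [r [wE GE [qx rx]]]] := CR7_pencil c k l m n p.
have lm0 : l - m != 0 by apply: contraNneq lmp0 => ->; rewrite mul0r.
set G := homogenize 2 _ in GE *.
have curveG : plane_curve 2 G.
  split=> //; rewrite GE ?conic_homog //; apply: conic_neq0_xx.
  by rewrite /= qx rx mulr0 add0r mulr1.
have cofG : Defs.cofactor w G ((l - m) *: jac q r).
  by rewrite /w wE GE; apply: cofactor_pencil; ring.
split; first by split=> //; exists ((l - m) *: jac q r).
exists 1, (fun=> 2), (fun=> G), (fun=> (l - m) *: jac q r).
exists (fun=> (l - m + l) / (l - m)); split=> //.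
by rewrite big_ord1 /w wE curl_pencil scalerA divfK // opprK.
Qed.

Lemma zariski_open_CR7 :
  zariski_open (fun v : 'rV[C]_6 => (v 0 (inord 2) - v 0 (inord 3)) * v 0 (inord 5) != 0).
Proof.
pose X (j : 'I_6) : {mpoly C[\dim {:'rV[C]_6}]} :=
  \sum_(i < \dim {:'rV[C]_6}) (vbasis {:'rV[C]_6})`_i 0 j *: 'X_i.
have XE j (v : 'rV[C]_6) : v 0 j = polyfun (X j) v.
  rewrite {1}(coord_vbasis (memvf v)) summxE /polyfun /X raddf_sum /=.
  by apply: eq_bigr => i _; rewrite mxE mevalZ mevalXU mulrC.
apply: (zariski_open_nonzero (f := (X (inord 2) - X (inord 3)) * X (inord 5))) => v.
by rewrite !XE /polyfun mevalM mevalB.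
Qed.

End CR7.

Theorem proposition6p8 (R : realType) :
  (exists U : 'rV[R[i]]_6 -> Prop,
     [/\ zariski_open U, exists v, U v
       & forall c k l m n p : R[i],
           U (\row_(j < 6) [:: c; k; l; m; n; p]`_j) ->
           let w := homogenize_form (CR7 c k l m n p) in
           integral_curve w 2 (homogenize 2 (CR7_conic c k l m n p)) /\
           darboux_integrable w]) /\
  (forall w : V3 R[i], X_CR7 w -> zariski_closure (@X22 R[i]) w).
Proof.
split; last exact: X_CR7_closure.
exists (fun v => (v 0 (inord 2) - v 0 (inord 3)) * v 0 (inord 5) != 0); split.
- exact: zariski_open_CR7.
- exists (\row_(j < 6) [:: 0; 0; 1; 0; 0; 1]`_j).
  by rewrite !mxE !inordK //= subr0 mulr1 oner_neq0.
- by move=> c k l m n p; rewrite !mxE !inordK //=; exact: CR7_integrable.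
Qed.
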